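(* Consider the continuous-time Matching Pennies game with discount rate $r>0$. For every mixed strategy $\mu^{\rm Aqua}\in\mathcal{M}^{\rm Aqua}$ and every $\varepsilon>0$, there exists a (non-mixed) strategy $\sigma^{\rm Bard}\in\mathcal{S}^{\rm Bard}$ such that $\gamma^{\rm Bard}(\mu^{\rm Aqua},\sigma^{\rm Bard})>1-\varepsilon$. Symmetrically, for every mixed strategy $\mu^{\rm Bard}\in\mathcal{M}^{\rm Bard}$ and every $\varepsilon>0$, there exists a (non-mixed) strategy $\sigma^{\rm Aqua}\in\mathcal{S}^{\rm Aqua}$ such that $\gamma^{\rm Aqua}(\sigma^{\rm Aqua},\mu^{\rm Bard})>1-\varepsilon$.
   Context: Game. The set of players is $I=\{{\rm Aqua},{\rm Bard}\}$, the action sets are $A^{\rm Aqua}=A^{\rm Bard}=\{a,b\}$, and the common discount rate is $r>0$. The instantaneous payoffs are $g^{\rm Bard}(x,y)=1$ if $x=y$ and $0$ if $x\ne y$, and $g^{\rm Aqua}(x,y)=1$ if $x\neq y$ and $0$ if $x=y$, where $x$ is Aqua's action and $y$ is Bard's. For $i\in I$, $-i$ denotes the other player. Controls. A control of player $i$ is a measurable function $u^i:[0,\infty)\to A^i$; $\mathcal{U}^i$ is the set of controls of player $i$ (controls that are equal a.e. being identified), $\mathcal{U}=\mathcal{U}^{\rm Aqua}\times\mathcal{U}^{\rm Bard}$. $\mathcal{U}^i$ is endowed with the distance $d(u^i,\widetilde u^i)=\int_0^\infty re^{-rt}\mathbf{1}_{\{u^i_t\ne\widetilde u^i_t\}}\,dt$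 and the associated Borel $\sigma$-algebra. The discounted payoff of player $i$ under $u\in\mathcal{U}$ is $\gamma^i(u)=\int_0^\infty re^{-rt}g^i(u(t))\,dt$. Strategies (non-anticipative with delay). A strategy of player $i$ is a measurable function $\sigma^i:\mathcal{U}^{-i}\to\mathcal{U}^i$ for which there is an increasing sequence of reals $0=t_0<t_1<\cdots$ converging to $\infty$ such that for every integer $n\ge 0$ and all $u^{-i},\widetilde u^{-i}\in\mathcal{U}^{-i}$: if $u^{-i}=\widetilde u^{-i}$ a.e. on $[0,t_n]$, then $\sigma^i(u^{-i})=\sigma^i(\widetilde u^{-i})$ a.e. on $[0,t_{n+1}]$. $\mathcal{S}^i$ is the set of strategies of player $i$. Mixed strategies. A mixed strategy of player $i$ is given by a probability space $(\Omega^i,\mathcal{F}^i,\mathbf{P}^i)$ and a measurable function $\mu^i:\Omega^i\times\mathcal{U}^{-i}\to\mathcal{U}^i$ such that $\mu^i(\omega^i,\cdot)\in\mathcal{S}^i$ for $\mathbf{P}^i$-a.e. $\omega^i$ (the sequence $(t_n)$ may depend on $\omega^i$). $\mathcal{M}^i$ is the set of mixed strategies of player $i$. A strategy in $\mathcal{S}^i$ is regarded as a mixed strategy with a one-point probability space. Expected payoff. A pair $\mu=(\mu^{\rm Aqua},\mu^{\rm Bard})$ of mixed strategies induces an (a.s. unique) $\mathcal{U}$-valued random variable $\widetilde u$ on the product probability space $(\Omega,\mathcal{F},\mathbf{P})$ of the two spaces $(\Omega^i,\mathcal{F}^i,\mathbf{P}^i)$ such that, $\mathbf{P}$-a.s.,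 $\mu^i(\omega^i,\widetilde u^{-i}(\omega))=\widetilde u^i(\omega)$ a.e. on $[0,\infty)$ for both $i\in I$. The expected discounted payoff of player $i$ is $\gamma^i(\mu)=\mathbf{E}[\gamma^i(\widetilde u)]$. *)

(* Defs.v *)
From HB Require Import structures.
From mathcomp Require Import all_boot all_order all_algebra.
From mathcomp Require Import all_classical all_reals all_analysis.
From mathcomp Require Import measurable_realfun.

Set Implicit Arguments.
Unset Strict Implicit.
Unset Printing Implicit Defensive.

Import Order.TTheory GRing.Theory Num.Theory.
Import numFieldNormedType.Exports.

Local Open Scope classical_set_scope.
Local Open Scope ring_scope.

Inductive player := Aqua | Bard.

(* The two actions a and b are encoded by the two booleans; [x] is Aqua's
   action and [y] is Bard's. *)
Definition stage_payoff (R : realType) (i : player) (x y : bool) : R :=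
  match i with
  | Aqua => (x != y)%:R
  | Bard => (x == y)%:R
  end.

Definition halfline_measure (R : realType) :=
  mrestr (@lebesgue_measure R) (measurable_itv `[(0 : R), +oo[).
HB.instance Definition _ (R : realType) :=
  Measure.on (@halfline_measure R).

(* Controls modulo equality a.e. on [0, +oo[. They are represented by functions
   on the whole line, whose values on the negative reals are irrelevant. The
   parameter [r] is only used by the distance below. Both players have the same
   action set, hence also the same controls and the same strategies. *)
Definition control (R : realType) (r : {posnum R}) : Type :=
  {mfun_ (@halfline_measure R), (measurableTypeR R) >-> bool}.

HB.instance Definition _ (R : realType) (r : {posnum R}) :=
  Choice.on (control r).

Definition control_fun (R : realType) (r : {posnum R}) (u : control r) :
  R -> bool := aqEqMfun_to_fun u.
Coercion control_fun : control >-> Funclass.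

Definition discount (R : realType) (r : {posnum R}) (t : R) : R :=
  r%:num * expR (- (r%:num * t)).

Definition control_dist (R : realType) (r : {posnum R}) (u v : control r) : R :=
  \int[lebesgue_measure]_(t in `[0, +oo[) (discount r t * (u t != v t)%:R).

Section control_metric.
Context (R : realType) (r : {posnum R}).
Implicit Types u v w : control r.
Local Notation mu := (@lebesgue_measure R).

Lemma measurable_control u : measurable_fun setT (u : R -> bool).
Proof. exact: (@measurable_funPT _ _ _ _ (repr u)). Qed.

Lemma control_eqP u v :
  u = v <-> (u : R -> bool) = v %[ae mu in `[0, +oo[%classic].
Proof.
have mI : measurable (`[0, +oo[ : set R) by exact: measurable_itv.
split=> [->|uv]; first exact: aeW.
rewrite -[u]reprK -[v]reprK; apply/eqmodP/asboolP.
case: uv => N [mN N0 uvN]; exists (N `|` ~` `[0, +oo[); split.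
- by apply: measurableU => //; exact: measurableC.
- change (mu ((N `|` ~` `[0, +oo[) `&` `[0, +oo[) = 0%E).
  rewrite setIUl setICl setU0.
  apply/eqP; rewrite -measure_le0 -N0 le_measure ?inE//.
  exact: measurableI.
- move=> t /= /not_implyP[_ ut].
  have [t0|] := pselect (`[0, +oo[%classic t); last by right.
  by left; apply: uvN => /= /(_ t0).
Qed.

Lemma discount_gt0 t : 0 < discount r t.
Proof. by rewrite mulr_gt0// expR_gt0. Qed.

Lemma discount_pdf t : 0 <= t -> discount r t = exponential_pdf r%:num t.
Proof. by move=> t0; rewrite exponential_pdfE// mulNr. Qed.

Lemma measurable_discount : measurable_fun setT (discount r).
Proof.
apply: measurable_funM => //; apply: measurableT_comp => //.
exact: measurableT_comp.
Qed.

Lemma measurable_neq u v :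
  measurable_fun setT (fun t => (u t != v t)%:R : R).
Proof.
have -> : (fun t => (u t != v t)%:R : R) =
    (fun t => if u t then if v t then 0 else 1 else if v t then 1 else 0).
  by apply/funext => t; case: (u t) (v t) => [] [].
by apply: measurable_fun_ifT; [exact: measurable_control| |];
  apply: measurable_fun_ifT => //; exact: measurable_control.
Qed.

Lemma integrable_control_dist u v :
  mu.-integrable `[0, +oo[
    (EFin \o (fun t => discount r t * (u t != v t)%:R)).
Proof.
apply: (@le_integrable _ _ _ mu _ _ _ (EFin \o exponential_pdf r%:num)) => //.
- apply/measurable_EFinP; apply: measurable_funTS; apply: measurable_funM.
    exact: measurable_discount.
  exact: measurable_neq.
- move=> t; rewrite /= in_itv/= andbT => t0.
  have d0 := ltW (discount_gt0 t).
  rewrite -discount_pdf// lee_fin !ger0_norm ?mulr_ge0//.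
  by rewrite ler_piMr// lern1 leq_b1.
- by apply: integrableS (integrable_exponential_pdf _).
Qed.

Lemma control_distxx u : control_dist u u = 0.
Proof.
rewrite /control_dist; under eq_Rintegral do rewrite eqxx mulr0.
by rewrite Rintegral_cst// mul0r.
Qed.

Lemma control_dist_eq0 u v : control_dist u v = 0 -> u = v.
Proof.
move=> uv0; apply/control_eqP.
have iuv := integrable_control_dist u v.
have uv0' : (\int[mu]_(t in `[0%R, +oo[)
    `|(discount r t * (u t != v t)%:R)%:E| = 0)%E.
  transitivity (control_dist u v)%:E; last by rewrite uv0.
  rewrite /control_dist /Rintegral fineK; last exact: integrable_fin_num.
  apply: eq_integral => t _.
  by rewrite gee0_abs// lee_fin mulr_ge0// ltW// discount_gt0.
have := (ae_eq_integral_abs mu (measurable_itv _) (measurable_int mu iuv)).1 uv0'.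
apply: filterS => t + t0 => /(_ t0) [] /eqP.
rewrite mulf_eq0 gt_eqF ?discount_gt0//= pnatr_eq0 eqb0 negbK.
by move/eqP.
Qed.

Lemma control_distC u v : control_dist u v = control_dist v u.
Proof. by apply: eq_Rintegral => t _; rewrite eq_sym. Qed.

Lemma control_dist_triangle v u w :
  control_dist u w <= control_dist u v + control_dist v w.
Proof.
have iuv := integrable_control_dist u v.
have ivw := integrable_control_dist v w.
rewrite /control_dist -RintegralD//; apply: le_Rintegral => //.
- exact: integrable_control_dist.
- exact: (integrableD _ iuv ivw).
- move=> t _; rewrite -mulrDr ler_wpM2l//; first exact/ltW/discount_gt0.
  by rewrite -natrD ler_nat; case: (u t) (v t) (w t) => [] [] [].
Qed.

HB.instance Definition _ := @isMetric.Build R (control r) (@control_dist R r)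
  control_distxx control_dist_eq0 control_distC control_dist_triangle.

(* Measurable types are pointed; the choice of the point is irrelevant. *)
Definition cst_control (x : bool) : control r :=
  \pi_({mfun_ (@halfline_measure R), (measurableTypeR R) >-> bool})%qT
    (cst x : {mfun (measurableTypeR R) >-> bool}).

HB.instance Definition _ := isPointed.Build (control r) (cst_control true).

End control_metric.

(* Borel sets of the metric topology given by [control_dist]. *)
Definition control_borel (R : realType) (r : {posnum R}) :
  set (set (control r)) := <<s [set A : set (control r) | open A] >>.

HB.instance Definition _ (R : realType) (r : {posnum R}) :=
  @isMeasurable.Build
    (sigma_display [set A : set (control r) | open A]) (control r)
    (@control_borel R r)
    (@sigma_algebra0 _ setT _) (@sigma_algebraC _ _)
    (@sigma_algebra_bigcup _ setT _).

Section game.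
Context (R : realType) (r : {posnum R}).
Local Notation mu := (@lebesgue_measure R).

Definition payoff (i : player) (u : control r * control r) : R :=
  \int[mu]_(t in `[0, +oo[) (discount r t * stage_payoff R i (u.1 t) (u.2 t)).

Definition agree_upto (T : R) (u v : control r) : Prop :=
  (u : R -> bool) = v %[ae mu in `[0, T]%classic].

Definition is_strategy (s : control r -> control r) : Prop :=
  measurable_fun setT s /\
  exists t : nat -> R,
    [/\ t 0%N = 0, forall n, t n < t n.+1, t @ \oo --> +oo &
        forall n u v, agree_upto (t n) u v -> agree_upto (t n.+1) (s u) (s v)].

Record strategy := Strategy {
  strategy_fun :> control r -> control r;
  strategyP : is_strategy strategy_fun
}.

Record mixed_strategy := MixedStrategy {
  mixed_display : measure_display;
  mixed_space : measurableType mixed_display;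
  mixed_prob : probability mixed_space R;
  mixed_fun : mixed_space * control r -> control r;
  mixed_measurable : measurable_fun setT mixed_fun;
  mixed_ae_strategy :
    {ae mixed_prob, forall w, is_strategy (fun u => mixed_fun (w, u))}
}.

Lemma pure_measurable (s : strategy) :
  measurable_fun setT (fun x : unit * control r => s x.2).
Proof.
by apply: measurableT_comp => //; case: (strategyP s).
Qed.

Lemma pure_ae_strategy (s : strategy) :
  {ae (\d_tt : probability unit R), forall w : unit, is_strategy (fun u => s u)}.
Proof. by apply: aeW => w; exact: strategyP. Qed.

Definition pure (s : strategy) : mixed_strategy :=
  MixedStrategy (pure_measurable s) (pure_ae_strategy s).

Definition profile_prob (ma mb : mixed_strategy) :
    probability (mixed_space ma * mixed_space mb)%type R :=
  (mixed_prob ma \x mixed_prob mb)%E.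

Definition induces (ma mb : mixed_strategy)
    (U : mixed_space ma * mixed_space mb -> control r * control r) : Prop :=
  measurable_fun setT U /\
  {ae profile_prob ma mb, forall w,
    mixed_fun (w.1, (U w).2) = (U w).1 /\ mixed_fun (w.2, (U w).1) = (U w).2}.

(* The induced random variable exists and is a.s. unique, so that the set below
   is a singleton; the default value -oo guarantees that a lower bound on the
   expected payoff cannot hold vacuously. *)
Definition expected_payoff (i : player) (ma mb : mixed_strategy) : \bar R :=
  xget -oo%E
    [set 'E_(profile_prob ma mb)[fun w => payoff i (U w)]%E
      | U in @induces ma mb].

End game.

(* Main.v *)
From HB Require Import structures.
Require Import Defs.
From mathcomp Require Import all_boot all_order all_algebra.
From mathcomp Require Import all_classical all_reals all_analysis.
From mathcomp Require Import measurable_realfun ring lra.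

Set Implicit Arguments.
Unset Strict Implicit.
Unset Printing Implicit Defensive.

Import Order.TTheory GRing.Theory Num.Theory.
Import numFieldNormedType.Exports.

Local Open Scope classical_set_scope.
Local Open Scope ring_scope.

(** Why pure delayed strategies almost solve the game.  Call opponent the player
    who uses the mixed strategy and responder the one who has to answer.  Once
    the randomness of the opponent is drawn, the opponent plays some measurable
    control, and a measurable control is nearly constant at small scales: for
    almost every time the majority action in a recent short block of time is
    the action played now (Lebesgue differentiation, [lagged_vote_eventually]).
    So a responder who plays according to the majority of a recent block is
    right most of the time, provided that the block length suits the control
    to be predicted.

    The difficulty is that the opponent observes the responder and can learn
    the block length in order to oscillate on the same scale.  The block length
    is therefore renewed in every phase, the phases being the intervals from
    k/M to (k+1)/M.  The opponent reacts only after a positive delay and, with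
    probability one, has finitely many reaction times before the horizon T.
    For large M all but a negligible proportion of the phases contain no
    reaction time ([sighted_phases_negligible]).  In such a phase, called blind,
    the play of the opponent depends only on what the responder did in earlier
    phases.

    The responder uses finitely many plans of action before a given phase, so the
    opponent faces the phase with one of finitely many random controls, and a
    single block length predicts all of them well in expectation
    ([losses_cvg0]).  The block lengths are chosen in this way, phase after
    phase ([small_regret]).  The expected time spent on wrong predictions is then
    at most the weight of the sighted phases, plus the small prediction errors
    in the blind ones, plus the discounted weight of the times after T
    ([regret_total]).

    A responder with finitely many plans also makes the induced play easy to
    construct: iterating the two strategies stabilises once the delays exceed T,
    and choosing the first self-consistent plan of a finite list is measurable.
    Both players are treated at once: the responder aims at copying the opponent
    (Bard) or at doing the opposite (Aqua), which is the boolean [flip]. *)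

(** * Discounting as a probability law on time *)

(** The exponential law of rate [r]: a player earns the probability that the
    reward is on when an exponential clock rings, so that payoffs and distances
    between controls become measures of sets of times. *)
Definition clock (R : realType) (r : {posnum R}) :
    probability (measurableTypeR R) R :=
  exponential_distribution_exponential_prob__canonical__probability_measure_Probability
    (gt0 r).

Section clock_theory.
Context (R : realType) (r : {posnum R}).
Local Notation lam := (@lebesgue_measure R).
Local Notation nu := (clock r).
Implicit Types (A B : set (measurableTypeR R)) (b : R -> bool) (s t : R).

Lemma clockE A :
  nu A = (\int[lam]_(t in A) (exponential_pdf r%:num t)%:E)%E.
Proof. by []. Qed.

Lemma clock_le_lebesgue A : measurable A -> (nu A <= r%:num%:E * lam A)%E.
Proof.
move=> mA; rewrite clockE -integral_cst//; apply: ge0_le_integral => //.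
- by move=> t _; rewrite lee_fin exponential_pdf_ge0.
- apply: measurable_funTS; apply/measurable_EFinP.
  exact: measurable_exponential_pdf.
- move=> t _; rewrite lee_fin; have [t0|t0] := ltP t 0.
    by rewrite lt0_exponential_pdf.
  rewrite exponential_pdfE// ler_piMr// -[leRHS](@expR0 R) ler_expR.
  by rewrite mulNr oppr_le0 mulr_ge0.
Qed.

Lemma clock_ge_lebesgue s A : measurable A -> A `<=` `[0, s] ->
  ((discount r s)%:E * lam A <= nu A)%E.
Proof.
move=> mA As; rewrite clockE -integral_cst//; apply: ge0_le_integral => //.
- by move=> t _; rewrite lee_fin ltW// discount_gt0.
- apply: measurable_funTS; apply/measurable_EFinP.
  exact: measurable_exponential_pdf.
- move=> t /As; rewrite /= in_itv/= => /andP[t0 ts].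
  rewrite lee_fin exponential_pdfE// /discount ler_wpM2l// ler_expR mulNr.
  by rewrite lerN2 ler_wpM2l.
Qed.

Lemma clock_neg : nu `]-oo, 0[%classic = 0%E.
Proof.
rewrite clockE integral0_eq// => t; rewrite /= in_itv/= => t0.
by rewrite lt0_exponential_pdf.
Qed.

(** Transfers statements that hold almost everywhere for the Lebesgue measure,
    in terms of which strategies are defined, to the discounted weight. *)
Lemma clock_null A : measurable A -> lam A = 0%E -> nu A = 0%E.
Proof.
move=> mA A0; apply/eqP; rewrite eq_le measure_ge0 andbT.
by rewrite (le_trans (clock_le_lebesgue mA))// A0 mule0.
Qed.

Lemma measurable_bset b : measurable_fun setT b -> measurable [set t | b t].
Proof. by move=> mb; rewrite -[X in measurable X]setTI; exact: mb. Qed.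

Lemma discounted_integralE b : measurable_fun setT b ->
  \int[lam]_(t in `[0, +oo[) (discount r t * (b t)%:R) =
  fine (nu [set t | b t]).
Proof.
move=> mb; rewrite /Rintegral; congr fine; rewrite clockE.
rewrite integral_mkcond [RHS]integral_mkcond; apply: eq_integral => t _.
rewrite !patchE; case: ifPn => t0.
  move: t0; rewrite inE/= in_itv/= andbT => t0.
  case: ifPn; rewrite ?inE ?notin_setE/= => bt.
    by rewrite bt mulr1 discount_pdf.
  by move/negP/negPf: bt => ->; rewrite mulr0.
case: ifPn => // _; rewrite lt0_exponential_pdf//.
by rewrite ltNge; apply: contra t0 => t0; rewrite inE/= in_itv/= t0.
Qed.

Lemma control_distE (u v : control r) :
  control_dist u v = fine (nu [set t | u t != v t]).
Proof.
apply: (@discounted_integralE (fun t => u t != v t)).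
have -> : (fun t => u t != v t) = (fun t => if u t then ~~ v t else v t).
  by apply/funext => t; case: (u t) (v t) => -[].
by apply: measurable_fun_ifT; [| apply: measurable_neg|]; exact: measurable_control.
Qed.

Definition reward i (x y : bool) : bool :=
  match i with Aqua => x != y | Bard => x == y end.

Lemma payoffE i (u : control r * control r) :
  payoff i u = fine (nu [set t | reward i (u.1 t) (u.2 t)]).
Proof.
rewrite -(@discounted_integralE (fun t => reward i (u.1 t) (u.2 t))).
  by rewrite /payoff; case: i.
have mneg (v : control r) : measurable_fun setT (fun t => ~~ v t).
  by apply: measurable_neg; exact: measurable_control.
have -> : (fun t => reward i (u.1 t) (u.2 t)) =
    (fun t => if u.1 t then (if i is Aqua then ~~ u.2 t else u.2 t)
              else (if i is Aqua then u.2 t else ~~ u.2 t)).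
  by apply/funext => t; case: i; case: (u.1 t) (u.2 t) => -[].
by apply: measurable_fun_ifT; case: i => //; exact: measurable_control.
Qed.

End clock_theory.

(** * Majority votes over short blocks predict a control *)

Section block_vote.
Context (R : realType) (r : {posnum R}).
Local Notation lam := (@lebesgue_measure R).
Local Notation nu := (clock r).
Implicit Types (u v : control r) (n j : nat) (x : bool) (s t : R).

Definition block n j : set (measurableTypeR R) := `[j%:R / n%:R, j.+1%:R / n%:R[.

Definition miss (B : set (measurableTypeR R)) x u : \bar R := nu (B `&` [set t | u t != x]).

(** The action played for the larger discounted weight of the block.  Comparing
    two distances makes the vote a Borel function of the control. *)
Definition vote n j u : bool :=
  (miss (block n j) true u < miss (block n j) false u)%E.

(** The vote is taken two blocks back and not on the block just finished: a
    prediction made at time [t] then depends on the control before [t - 1 / n]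
    only, which gives a uniform delay that does not have to be aligned with
    the grid. *)
Definition lagged_vote n j u : bool :=
  if j is j'.+2 then vote n j' u else false.

Lemma measurable_block n j : measurable (block n j).
Proof. exact: measurable_itv. Qed.

Lemma measurable_differ u x : measurable [set t | u t != x].
Proof.
apply: measurable_bset; case: x.
  rewrite (_ : (fun t => _) = (fun t => ~~ u t)).
    by apply: measurable_neg; exact: measurable_control.
  by apply/funext => t; case: (u t).
rewrite (_ : (fun t => _) = u); first exact: measurable_control.
by apply/funext => t; case: (u t).
Qed.

Lemma miss_split B x u : measurable B ->
  (nu B = miss B x u + miss B (~~ x) u)%E.
Proof.
move=> mB; rewrite /miss -measureU//.
- rewrite -setIUr (_ : _ `|` _ = setT) ?setIT//.
  by apply/seteqP; split=> // t _ /=; case: (u t) x => -[]; [right|left|left|right].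
- by apply: measurableI => //; exact: measurable_differ.
- by apply: measurableI => //; exact: measurable_differ.
- by apply/seteqP; split=> // t [] [_ /= ux] [_ /=]; move: ux; case: (u t); case: (x).
Qed.

(** A vote differs from an action only if that action is missed on at least half
    of the block. *)
Lemma vote_wrong n j u x : vote n j u != x ->
  (nu (block n j) <= miss (block n j) x u + miss (block n j) x u)%E.
Proof.
move=> vx; rewrite (miss_split x u (measurable_block n j)) leeD2l//.
move: vx; rewrite /vote; case: x => /=; case: ltP => //; last by move/ltW.
Qed.

Lemma block_truncn n t : (0 < n)%N -> 0 <= t -> block n (Num.truncn (t * n%:R)) t.
Proof.
move=> n0 t0; rewrite /block /= in_itv/= ler_pdivrMr ?ltr0n//.
by rewrite ltr_pdivlMr ?ltr0n// truncn_itv// mulr_ge0.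
Qed.

Lemma lebesgue_block n j : (0 < n)%N -> lam (block n j) = (n%:R^-1)%:E.
Proof.
move=> n0; rewrite /block lebesgue_measure_itv/= lte_fin ltr_pM2r ?invr_gt0 ?ltr0n//.
by rewrite ltr_nat ltnSn -EFinB -mulrBl -natrB// subSnn mul1r.
Qed.

Lemma locally_integrable_control u : locally_integrable setT (fun t => (u t)%:R : R).
Proof.
have mu : measurable_fun setT (fun t => (u t)%:R : R).
  rewrite (_ : (fun t => _) = (fun t => if u t then 1 else 0)).
    by apply: measurable_fun_ifT => //; exact: measurable_control.
  by apply/funext => t; case: (u t).
split=> //; first exact: openT.
move=> K _ cK; apply: (@le_lt_trans _ _ (\int[lam]_(t in K) (cst 1%E) t)%E).
  apply: ge0_le_integral => //.
  - exact: compact_measurable.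
  - apply/measurable_EFinP; apply: measurableT_comp => //.
    exact: measurable_funTS.
  - by move=> t _; rewrite lee_fin; case: (u t); rewrite ?normr1 ?normr0.
rewrite integral_cst ?mul1e; last exact: compact_measurable.
exact: compact_finite_measure.
Qed.

(** Let [t] be a Lebesgue point of the control.  The voting block lies in the ball
    of radius [3 / n] around [t] and occupies a fixed fraction of it; a wrong vote
    would make the control differ from its value at [t] on a fixed fraction of
    that ball, and the mean deviation over the ball would not vanish. *)
Lemma lagged_vote_eventually u :
  {ae lam, forall t, 0 < t ->
    \forall n \near \oo, lagged_vote n (Num.truncn (t * n%:R)) u = u t}.
Proof.
have := lebesgue_differentiation (locally_integrable_control u).
apply: filterS; first exact: (ae_filter_ringOfSetsType lam).
move=> t ut t0.
(* The ball has length 6 / n and the block 1 / n; half of the block is missed,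
   and the discounted weight has a density between discount r t and r there. *)
pose c : R := discount r t / (12 * r%:num).
have c0 : (0%:E < c%:E)%E by rewrite lte_fin divr_gt0// discount_gt0.
have [d /= d0 dP] := ut _ (open_ereal_lt' c0).
near=> n.
have n0 : (0 < n%:R :> R) by rewrite ltr0n; near: n; exact: nbhs_infty_gt.
have tn : (2 <= Num.truncn (t * n%:R))%N.
  rewrite truncn_ge_nat ?(mulr_ge0 (ltW t0))// -ler_pdivrMl// ltW//.
  by near: n; exact: nbhs_infty_gtr.
have nd : 3 / n%:R < d.
  rewrite ltr_pdivrMr// mulrC -ltr_pdivrMr//; near: n; exact: nbhs_infty_gtr.
have := block_truncn (n := n) _ (ltW t0); rewrite -(ltr0n R) => /(_ n0).
case: (Num.truncn _) tn => [//|[//|j _]].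
rewrite /block/= in_itv/= => /andP[jt tj].
apply/eqP/negPn/negP => /vote_wrong votej.
have {dP} := dP (3 / n%:R); rewrite /= sub0r normrN gtr0_norm ?divr_gt0//.
move=> /(_ nd isT).
apply/negP; rewrite -leNgt /davg /iavg.
set B := block n j in votej; set D := [set s | u s != u t].
have mD : measurable D by exact: measurable_differ.
have mB : measurable B by exact: measurable_block.
have Bt : B `<=` `[0, t].
  move=> s; rewrite /B/block/= !in_itv/= => /andP[js sj].
  rewrite (le_trans _ js) ?divr_ge0//= (le_trans (ltW sj))//.
  by rewrite (le_trans _ jt)// ler_pM2r ?invr_gt0// ler_nat ltnW.
have Bball : B `<=` ball t (3 / n%:R).
  move=> s; rewrite /B/block/ball/= !in_itv/= => /andP[js sj].
  rewrite ger0_norm.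
    rewrite ltrBlDr (lt_le_trans tj)// (le_trans _ (lerD (lexx _) js))//.
    by rewrite -mulrDl ler_pM2r ?invr_gt0// -natrD ler_nat.
  rewrite subr_ge0 (le_trans (ltW sj))//.
  by rewrite (le_trans _ jt)// ler_pM2r ?invr_gt0// ler_nat ltnW.
have BDle : (lam (B `&` D) <= \int[lam]_(y in ball t (3 / n%:R))
    `|((center ((u t)%:R) \o (fun t0 : R => (u t0)%:R : R)) y)%:E|)%E.
  have mball : measurable (ball t (3 / n%:R)) by exact: measurable_ball.
  apply: (@le_trans _ _ (\int[lam]_(y in B `&` D)
    `|((center ((u t)%:R) \o (fun t0 : R => (u t0)%:R : R)) y)%:E|)%E).
    rewrite -[leLHS]mul1e -integral_cst ?le_eqVlt; last exact: measurableI.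
    apply/orP; left; apply/eqP; apply: eq_integral => s.
    rewrite inE => -[_]; rewrite /D/= => us; congr EFin.
    by case: (u s) (u t) us => -[]//= _; rewrite ?subr0 ?sub0r ?normrN normr1.
  apply: ge0_subset_integral => //.
  - exact: measurableI.
  - apply/measurableT_comp => //; apply/measurable_EFinP => /=.
    have [muf _ _] := locally_integrable_control u.
    by apply: measurable_funD => //; exact: measurable_funTS.
  - by move=> s [/Bball].
apply: (le_trans _ (lee_wpmul2l _ BDle)); last first.
  by rewrite inve_ge0.
have BDfin : lam (B `&` D) \is a fin_num.
  rewrite ge0_fin_numE// (@le_lt_trans _ _ (lam B))//.
    by rewrite le_measure ?inE//; exact: measurableI.
  by rewrite lebesgue_block ?ltry// -(ltr0n R).
have [l Ll] : exists l, lam (B `&` D) = l%:E.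
  by exists (fine (lam (B `&` D))); rewrite fineK.
have hB : discount r t / n%:R <= r%:num * l + r%:num * l.
  rewrite -lee_fin [leRHS]EFinD [X in (_ <= X + X)%E]EFinM -Ll.
  apply: (@le_trans _ _ (nu B)); last first.
    apply: (le_trans votej); apply: leeD; apply: clock_le_lebesgue;
    exact: measurableI.
  apply: le_trans (clock_ge_lebesgue r mB Bt).
  by rewrite lebesgue_block -?(ltr0n R)// EFinM.
rewrite lebesgue_measure_ball ?divr_ge0// Ll inver ifF; last first.
  by rewrite mulrn_eq0/= mulf_eq0 invr_eq0 !gt_eqF.
rewrite -EFinM lee_fin.
have {}hB : discount r t <= (r%:num * l + r%:num * l) * n%:R.
  by rewrite -ler_pdivrMr.
rewrite /c ler_pdivrMr; last by rewrite mulr_gt0.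
apply: (le_trans hB); rewrite le_eqVlt; apply/orP; left; apply/eqP.
rewrite -mulr_natr; field.
by rewrite gt_eqF.
Unshelve. all: by end_near. Qed.

End block_vote.

(** * Measurability and agreement of controls *)

Section control_measurability.
Context (R : realType) (r : {posnum R}).
Local Notation nu := (clock r).
Implicit Types (u v : control r) (n j : nat) (x : bool) (B : set (measurableTypeR R)).

(** Strict upper level sets are open, hence generators of the sigma-algebra on
    controls.  Distances to a control and the weights [miss] are of this kind. *)
Lemma lipschitz_measurable (f : control r -> R) :
  (forall u v, f u <= f v + control_dist u v) -> measurable_fun setT f.
Proof.
move=> fL _; apply: (measurability _ (RGenOInfty.measurableE R)) => //.
move=> _ [_ [x ->] <-]; rewrite setTI; apply: sub_sigma_algebra => /=.
rewrite openE => u; rewrite /= in_itv/= andbT => fu.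
apply/nbhs_ballP; exists (f u - x) => /=; first by rewrite subr_gt0.
move=> v; rewrite ballEmdist /= => uv; rewrite in_itv/= andbT.
rewrite -(ltrD2r (control_dist u v)) (lt_le_trans _ (fL u v))//.
by rewrite -ltrBrDl.
Qed.

(** Points are closed, which makes the equations defining an induced play
    measurable. *)
Lemma measurable_fiber d (T : measurableType d) (X : T -> control r) v :
  measurable_fun setT X -> measurable [set w | X w = v].
Proof.
move=> mX.
have md : measurable_fun setT (fun u => control_dist u v).
  apply: lipschitz_measurable => u u'.
  by rewrite addrC; exact: control_dist_triangle.
have -> : [set w | X w = v] = X @^-1` ((fun u => control_dist u v) @^-1` [set 0]).
  apply/seteqP; split=> w /= => [->|]; first exact: control_distxx.
  exact: control_dist_eq0.
rewrite -[X in measurable X]setTI; apply: mX => //.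
by rewrite -[X in measurable X]setTI; exact: md.
Qed.

Lemma measurable_miss B x : measurable B -> measurable_fun setT (miss (r := r) B x).
Proof.
move=> mB.
have mD u : measurable (B `&` [set t | u t != x]).
  by apply: measurableI => //; exact: measurable_differ.
have -> : miss B x = EFin \o (fun u => fine (miss B x u)).
  by apply/funext => u /=; rewrite fineK//; apply: fin_num_measure; exact: mD.
apply/measurable_EFinP; apply: lipschitz_measurable => u v.
have muv : measurable [set t | u t != v t].
  rewrite (_ : [set t | u t != v t] =
      ([set t | u t != true] `&` [set t | v t != false]) `|`
      ([set t | u t != false] `&` [set t | v t != true])).
    by apply: measurableU; apply: measurableI; exact: measurable_differ.
  apply/seteqP; split=> t /=; case: (u t); case: (v t) => //= uv;
    by [left | right | case: uv => -[]].
rewrite control_distE -lee_fin EFinD !fineK;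
  try by apply: fin_num_measure; do ?exact: mD.
apply: (@le_trans _ _ _ _ _ _ (measureU2 nu (mD v) muv)).
apply: le_measure; rewrite ?inE;
  [exact: mD|by apply: measurableU; [exact: mD|exact: muv]|].
move=> t [Bt /= ux]; have [vx|vx] := eqVneq (v t) x; last by left.
by right; rewrite /= vx.
Qed.

Lemma measurable_vote n j : measurable_fun setT (vote (r := r) n j).
Proof.
by apply: measurable_fun_lte; apply: measurable_miss; exact: measurable_block.
Qed.

Lemma measurable_lagged_vote n j : measurable_fun setT (lagged_vote (r := r) n j).
Proof.
case: j => [|[|j]]; [exact: measurable_cst|exact: measurable_cst|].
exact: measurable_vote.
Qed.

End control_measurability.

Section agreement.
Context (R : realType) (r : {posnum R}).
Local Notation lam := (@lebesgue_measure R).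
Local Notation nu := (clock r).
Implicit Types (u v w : control r) (n j : nat) (x : bool) (B : set (measurableTypeR R)) (s t : R).

Let aeF := ae_filter_ringOfSetsType lam.

Lemma agree_upto_le s s' u v : s <= s' -> agree_upto s' u v -> agree_upto s u v.
Proof.
move=> ss'; apply: (@filterS _ _ aeF) => t uv; rewrite /= in_itv/= => /andP[t0 ts].
by apply: uv; rewrite /= in_itv/= t0 (le_trans ts).
Qed.

(** Agreement is required on a closed interval, but phases and blocks are
    half-open; the missing end point is negligible. *)
Lemma agree_upto_open s u v :
  {ae lam, forall t, 0 <= t < s -> u t = v t} -> agree_upto s u v.
Proof.
have sN : {ae lam, forall t, t != s}.
  exists [set s]; split=> //; first exact: lebesgue_measure_set1.
  by move=> t /= /negP; rewrite negbK => /eqP.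
move=> uv; apply: (@filterS2 _ _ aeF _ _ _ _ sN uv) => t ts {}uv.
by rewrite /= in_itv/= => /andP[t0 tles]; apply: uv; rewrite t0 lt_neqAle ts.
Qed.

Lemma miss_agree s B x u v : measurable B -> B `<=` `[0, s] ->
  agree_upto s u v -> miss B x u = miss B x v.
Proof.
move=> mB Bs [N [mN N0 uvN]].
have le_miss u' v' : (forall t, ~ N t -> B t -> u' t = v' t) ->
    (miss B x u' <= miss B x v')%E.
  move=> u'v'; rewrite /miss -[leRHS]adde0 -(clock_null r mN N0).
  have mD w : measurable (B `&` [set t | w t != x]).
    by apply: measurableI => //; exact: measurable_differ.
  apply: (@le_trans _ _ _ _ _ _ (measureU2 nu (mD v') mN)).
  apply: le_measure; rewrite ?inE;
    [exact: mD|by apply: measurableU; [exact: mD|exact: mN]|].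
  move=> t [Bt /= ux]; have [Nt|Nt] := pselect (N t); first by right.
  by left; split => //=; rewrite -u'v'.
have uv t : ~ N t -> B t -> u t = v t.
  by move=> Nt Bt; apply: contrapT => uvt; apply/Nt/uvN => /(_ (Bs _ Bt)).
by apply/eqP; rewrite eq_le !le_miss// => t Nt Bt; rewrite uv.
Qed.

Lemma vote_agree s n j u v : (0 < n)%N -> j.+1%:R <= s * n%:R ->
  agree_upto s u v -> vote n j u = vote n j v.
Proof.
move=> n0 js uv; rewrite /vote.
have Bs : block n j `<=` `[0, s].
  move=> t; rewrite /block/= !in_itv/= => /andP[jt tj].
  rewrite (le_trans _ jt)//= ltW// (lt_le_trans tj)//.
  by rewrite ler_pdivrMr// ltr0n.
have mB := @measurable_block R n j.
by rewrite !(miss_agree _ mB Bs uv).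
Qed.

(** Conversely to [vote_agree], votes determine a control: at almost every time it
    is the limit of its lagged votes.  Hence agreement can be tested by countably
    many measurable conditions. *)
Lemma agree_of_votes s u v :
  (forall n j, (0 < n)%N -> j.+1%:R <= s * n%:R -> vote n j u = vote n j v) ->
  agree_upto s u v.
Proof.
move=> uv; apply: agree_upto_open.
have t0N : {ae lam, forall t, t != 0}.
  exists [set 0]; split=> //; first exact: lebesgue_measure_set1.
  by move=> t /= /negP; rewrite negbK => /eqP.
have := @filterS3 _ _ aeF _ _ _ _ _ t0N (lagged_vote_eventually u)
  (lagged_vote_eventually v); apply => t tN0 ut vt /andP[t0 ts].
have {}t0 : 0 < t by rewrite lt_neqAle eq_sym tN0.
near \oo => n.
have n0 : (0 < n)%N by near: n; exact: nbhs_infty_gt.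
have <- : lagged_vote n (Num.truncn (t * n%:R)) u = u t by near: n; exact: ut.
have <- : lagged_vote n (Num.truncn (t * n%:R)) v = v t by near: n; exact: vt.
have : (Num.truncn (t * n%:R))%:R <= s * n%:R.
  rewrite (le_trans _ (ler_wpM2r (ler0n _ n) (ltW ts)))//.
  by rewrite -truncn_ge_nat// mulr_ge0// ltW.
case: (Num.truncn _) => [//|[//|j]] /= js; apply: uv => //.
by rewrite (le_trans _ js)// ler_nat.
Unshelve. all: by end_near. Qed.

End agreement.

(** * Prediction errors in one phase *)

Section bounded_convergence.
Local Open Scope ereal_scope.
Context d (T : measurableType d) (R : realType) (P : probability T R).

(** Dominated convergence with a constant bound, used for the law of time as well
    as for the law of the opponent's randomness. *)
Lemma bounded_cvg0 (f : nat -> T -> \bar R) (C : R) :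
  (forall n, measurable_fun setT (f n)) ->
  (forall n t, 0 <= f n t <= C%:E) ->
  {ae P, forall t, f ^~ t @ \oo --> 0} ->
  \int[P]_t f n t @[n --> \oo] --> 0.
Proof.
move=> mf f0C fcv.
have := @dominated_convergence _ _ _ P setT measurableT f (cst 0) (cst C%:E) mf.
case=> //.
- by apply: filterS fcv => t ft _.
- exact: finite_measure_integrable_cst.
- by apply: aeW => t n _; have /andP[f0 fC] := f0C n t; rewrite gee0_abs.
- by move=> _ _; rewrite integral0.
Qed.

Lemma measure_cvg0 (A : nat -> set T) :
  (forall n, measurable (A n)) ->
  {ae P, forall t, \forall n \near \oo, ~ A n t} ->
  P (A n) @[n --> \oo] --> 0.
Proof.
move=> mA Aev.
rewrite (_ : (fun n => P (A n)) = fun n => \int[P]_t (\1_(A n) t)%:E); last first.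
  by apply/funext => n; rewrite integral_indic// setIT.
apply: (@bounded_cvg0 _ 1%R).
- by move=> n; apply/measurable_EFinP; exact: measurable_indic.
- by move=> n t; rewrite !lee_fin indicE; case: (_ \in _); rewrite ?lexx ler01.
- apply: filterS Aev => t At; apply: cvg_near_cst.
  by apply: filterS At => n Ant; rewrite indicE memNset.
Qed.

End bounded_convergence.

Section phase_loss.
Context (R : realType) (r : {posnum R}).
Local Notation lam := (@lebesgue_measure R).
Local Notation nu := (clock r).
Implicit Types (u v : control r) (n j k d : nat) (x : bool) (s t : R).

(** Phase [k] is cut into [d] blocks of the grid of mesh [1 / (M * d)]; summing
    over the blocks, on each of which the prediction is constant, keeps the
    error measurable in the control. *)
Definition phase_loss M d k u : \bar R :=
  (\sum_(i < d) let j := (k * d + i)%N in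
     miss (block (M * d) j) (lagged_vote (M * d) j u) u)%E.

Definition wrong_times n u : set (measurableTypeR R) :=
  \bigcup_j (block n j `&` [set t | u t != lagged_vote n j u]).

Lemma measurable_wrong n u : measurable (wrong_times n u).
Proof.
apply: bigcupT_measurable => j; apply: measurableI; first exact: measurable_block.
exact: measurable_differ.
Qed.

Lemma block_index n j t : (0 < n)%N -> block n j t -> Num.truncn (t * n%:R) = j.
Proof.
move=> n0; rewrite /block /= in_itv/= ler_pdivrMr ?ltr0n//.
by rewrite ltr_pdivlMr ?ltr0n// => /truncn_def.
Qed.

(** Almost every time is eventually predicted correctly. *)
Lemma wrong_times_cvg0 u : nu (wrong_times n u) @[n --> \oo] --> 0%E.
Proof.
apply: measure_cvg0; first by move=> n; exact: measurable_wrong.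
have [N [mN N0 NP]] := lagged_vote_eventually u.
exists (N `|` `]-oo, 0[ `|` [set 0]); split.
- by do !apply: measurableU => //.
- have nuN0 := clock_null r mN N0.
  apply: null_set_setU => //; first exact: measurableU.
    by apply: null_set_setU => //; exact: clock_neg.
  by apply: clock_null => //; exact: lebesgue_measure_set1.
- move=> t /= tw; have [t0|t0|->] := ltgtP t 0; [by left; right| |by right].
  left; left; apply: NP => /= /(_ t0) ut; apply: tw.
  near=> n => -[j _ [jt /=]].
  have n0 : (0 < n)%N by near: n; exact: nbhs_infty_gt.
  rewrite -(block_index n0 jt).
  have -> : lagged_vote n (Num.truncn (t * n%:R)) u = u t by near: n; exact: ut.
  by rewrite eqxx.
Unshelve. all: by end_near. Qed.

Lemma phase_loss_wrong M d k u : (0 < M * d)%N ->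
  (phase_loss M d k u <= nu (wrong_times (M * d) u))%E.
Proof.
move=> n0; rewrite /phase_loss/= /miss.
rewrite -(measure_bigsetU_ord _ (fun _ => true) (F := fun i : 'I_d =>
   block (M * d) (k * d + i) `&`
   [set t | u t != lagged_vote (M * d) (k * d + i) u])).
- apply: le_measure; rewrite ?inE.
  + apply: bigsetU_measurable => i _; apply: measurableI.
      exact: measurable_block.
    exact: measurable_differ.
  + exact: measurable_wrong.
  + rewrite -(bigcup_mkord d (fun i => block (M * d) (k * d + i) `&`
      [set t | u t != lagged_vote (M * d) (k * d + i) u])).
    by move=> t [i /= _ it]; exists (k * d + i)%N.
- move=> i; apply: measurableI; [exact: measurable_block|].
  exact: measurable_differ.
- move=> i j _ _ [t [[/= it _] [/= jt _]]].
  apply/val_inj => /=; apply: (@addnI (k * d)).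
  by rewrite -(block_index n0 it) -(block_index n0 jt).
Qed.

Lemma phase_loss_ge0 M d k u : (0 <= phase_loss M d k u)%E.
Proof. by apply: sume_ge0 => i _; exact: measure_ge0. Qed.

Lemma phase_loss_le1 M d k u : (0 < M * d)%N -> (phase_loss M d k u <= 1)%E.
Proof.
by move=> n0; rewrite (le_trans (phase_loss_wrong _ _ n0))// probability_le1//;
  exact: measurable_wrong.
Qed.

Lemma measurable_phase_loss M d k : measurable_fun setT (phase_loss M d k).
Proof.
apply: emeasurable_sum => i; rewrite /=.
set n := (M * d)%N; set j := (k * d + i)%N.
rewrite (_ : (fun u => _) = (fun u => if lagged_vote n j u
    then miss (block n j) true u else miss (block n j) false u)).
  apply: measurable_fun_ifT; first exact: measurable_lagged_vote.
    by apply: measurable_miss; exact: measurable_block.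
  by apply: measurable_miss; exact: measurable_block.
by apply/funext => u; case: (lagged_vote _ _ _).
Qed.

Lemma phase_loss_cvg0 M k u : (0 < M)%N ->
  phase_loss M d.+1 k u @[d --> \oo] --> 0%E.
Proof.
move=> M0; apply: (@squeeze_cvge _ _ _ _ (cst 0%E) _
  (fun d => nu (wrong_times (M * d.+1) u))).
- by apply: nearW => d; rewrite phase_loss_ge0 phase_loss_wrong// muln_gt0 M0.
- exact: cvg_cst.
- apply: (cvg_comp (fun d => M * d.+1)%N (fun n => nu (wrong_times n u))
    _ (wrong_times_cvg0 u)).
  apply/cvgnyPge => N; near=> d; rewrite (@leq_trans d) ?leq_pmull//.
    by near: d; exact: nbhs_infty_ge.
  by rewrite (leq_trans (leqnSn d))// leq_pmull.
Unshelve. all: by end_near. Qed.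

End phase_loss.

(** * Step controls and the responder's strategies *)

Section plans.
Context (R : realType) (r : {posnum R}).
Local Notation lam := (@lebesgue_measure R).
Implicit Types (u v : control r) (n j d : nat) (s t : R).

(** Codes of step controls, latest phase first: the entry [(d, bits)] followed by
    [k] others stands for the values on the grid of mesh [1 / (M * d.+1)] during phase [k].
    Codes form a countable type, and those that a given strategy uses a finite
    set. *)
Definition plan := seq (nat * seq bool).
Implicit Types p : plan.

Fixpoint plan_value (M : nat) p t : bool :=
  if p is (d, bits) :: p' then
    if t * M%:R < (size p')%:R then plan_value M p' t
    else nth false bits (Num.truncn (t * (M * d.+1)%:R))
  else false.

Lemma measurable_of_truncn n (g : nat -> bool) :
  measurable_fun (setT : set (measurableTypeR R))
    (fun t : R => g (Num.truncn (t * n%:R))).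
Proof.
have mtn : measurable_fun (setT : set (measurableTypeR R)) (fun t : R => t * n%:R).
  exact: measurable_funM.
have mlt k : measurable [set t : measurableTypeR R | (Num.truncn (t * n%:R) <= k)%N].
  rewrite (_ : [set _ | _] = [set t : measurableTypeR R | t * n%:R < k.+1%:R]).
    by apply: (@measurable_bset R); apply: measurable_fun_ltr.
  by apply/seteqP; split=> t /=; rewrite truncn_le_nat.
move=> _; apply: (measurable_fun_bool true) => //.
rewrite setTI (_ : _ @^-1` _ = \bigcup_(j in [set j | g j])
    [set t | Num.truncn (t * n%:R) = j]).
  apply: bigcup_measurable => -[|j] _.
    rewrite (_ : [set _ | _] = [set t | (Num.truncn (t * n%:R) <= 0)%N])//.
    by apply/seteqP; split=> t /=; rewrite leqn0 => /eqP.
  rewrite (_ : [set _ | _] = [set t | (Num.truncn (t * n%:R) <= j.+1)%N] `\`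
     [set t | (Num.truncn (t * n%:R) <= j)%N]); first exact: measurableD.
  apply/seteqP; split=> t /=; first by move=> ->; rewrite ltnn.
  by move=> [jt /negP]; rewrite -ltnNge => tj; apply/eqP; rewrite eqn_leq jt.
apply/seteqP; split=> t /= => [gt|[j gj ->]//].
by exists (Num.truncn (t * n%:R)).
Qed.

Lemma measurable_plan_value M p :
  measurable_fun (setT : set (measurableTypeR R)) (plan_value M p).
Proof.
elim: p => [|[d bits] p IH] /=; first exact: measurable_cst.
apply: measurable_fun_ifT => //; last exact: measurable_of_truncn.
by apply: measurable_fun_ltr => //; exact: measurable_funM.
Qed.

(** [plan_value] packed with its measurability, as required by the quotient that
    defines controls. *)
Definition plan_fun M p : {mfun (measurableTypeR R) >-> bool} :=
  @MeasurableFun.Pack _ _ (measurableTypeR R) bool (plan_value M p)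
    (MeasurableFun.Class (isMeasurableFun.Build _ _ (measurableTypeR R) bool
      (plan_value M p) (measurable_plan_value M p))).

Definition play M p : control r :=
  \pi_({mfun_ (@halfline_measure R), (measurableTypeR R) >-> bool})%qT
    (plan_fun M p).

Lemma playE M p : {ae lam, forall t, 0 <= t -> play M p t = plan_value M p t}.
Proof.
have /eqmodP/asboolP[N [mN N0 NP]] : repr (play M p) =
    (plan_fun M p)
    %[mod {mfun_ (@halfline_measure R), (measurableTypeR R) >-> bool}]%qT.
  by rewrite reprK.
exists (N `&` `[0, +oo[); split => //; first exact: measurableI.
move=> t /= /not_implyP[t0 tp]; split; last by rewrite in_itv/= t0.
by apply: NP => /= /(_ I).
Qed.

(** The responder's strategy with [d.+1] blocks in phase [k] for the entry [d] of
    [l] followed by [k] others.  All the votes since time 0 are recorded on the grid of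
    the phase, although [plan_value] reads those of the phase itself, which avoids
    shifting indices. *)
Fixpoint response (flip : bool) M (l : seq nat) u : plan :=
  if l is d :: l' then
    (d, mkseq (fun j => flip (+) lagged_vote (M * d.+1) j u) ((size l').+1 * d.+1))
      :: response flip M l' u
  else [::].

(** A finite list containing all the codes that [response] can produce. *)
Fixpoint plans (l : seq nat) : seq plan :=
  if l is d :: l' then
    [seq (d, tval bits) :: p | bits <- enum {: ((size l').+1 * d.+1).-tuple bool},
                               p <- plans l']
  else [:: [::]].

Lemma size_response flip M l u : size (response flip M l u) = size l.
Proof. by elim: l => //= d l ->. Qed.

Lemma response_in_plans flip M l u : response flip M l u \in plans l.
Proof.
elim: l => //= d l IH.
pose b := mkseq (fun j => flip (+) lagged_vote (M * d.+1) j u)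
  ((size l).+1 * d.+1).
have bs : size b == ((size l).+1 * d.+1)%N by rewrite size_mkseq.
apply/allpairsP; exists (Tuple bs, response flip M l u); split=> //=.
by rewrite mem_enum.
Qed.

Lemma response_now flip M d l u t : (0 < M)%N ->
  (size l)%:R <= t * M%:R < (size l).+1%:R ->
  plan_value M (response flip M (d :: l) u) t =
  flip (+) lagged_vote (M * d.+1) (Num.truncn (t * (M * d.+1)%:R)) u.
Proof.
move=> M0 /andP[lt tl] /=; rewrite size_response ltNge lt/= nth_mkseq//.
have t0 : 0 <= t.
  have M0' : 0 < M%:R :> R by rewrite ltr0n.
  by rewrite -(pmulr_lge0 _ M0') (le_trans _ lt).
rewrite truncn_lt_nat ?mulr_ge0// natrM mulrA natrM ltr_pM2r//.
Qed.

Lemma response_after flip M l u t : 0 <= t -> (size l)%:R <= t * M%:R ->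
  plan_value M (response flip M l u) t = false.
Proof.
case: l => //= d l t0 lt; rewrite size_response ltNge (le_trans _ lt) ?ler_nat//=.
rewrite nth_default// size_mkseq truncn_ge_nat ?mulr_ge0//.
by rewrite natrM (natrM _ M) mulrA ler_pM2r.
Qed.

(** Two blocks of lag leave a delay of one block, hence of any [h] that is shorter
    than the blocks of all phases. *)
Lemma response_delay flip M l u v s h t :
  (0 < M)%N -> (forall d, d \in l -> h * (M * d.+1)%:R <= 1) ->
  0 <= t <= s + h -> agree_upto s u v ->
  plan_value M (response flip M l u) t = plan_value M (response flip M l v) t.
Proof.
move=> M0 + /andP[t0 tsh] uv; elim: l => [//|d l IH] hl /=.
rewrite !size_response IH; last by move=> d' d'l; apply: hl; rewrite inE d'l orbT.
case: ifP => _; first by [].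
set n := (M * d.+1)%N.
have [jn|jn] := ltnP (Num.truncn (t * n%:R)) ((size l).+1 * d.+1); last first.
  by rewrite !nth_default// size_mkseq.
have : (Num.truncn (t * n%:R))%:R <= s * n%:R + 1.
  rewrite (@le_trans _ _ (t * n%:R))//.
    by rewrite -truncn_ge_nat// mulr_ge0.
  rewrite (le_trans (ler_wpM2r (ler0n _ n) tsh))// mulrDl lerD2l.
  by apply: hl; rewrite inE eqxx.
rewrite !nth_mkseq//; case: (Num.truncn _) => [//|[//|j]] /= js; congr (_ (+) _).
apply: vote_agree uv; first by rewrite muln_gt0 M0.
by rewrite -(lerD2r 1) natr1.
Qed.

Lemma measurable_response flip M l p :
  measurable [set u | response flip M l u = p].
Proof.
elim: l p => [|d l IH] [|[d' b] p] /=.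
- rewrite [X in measurable X](_ : _ = setT)//; by apply/seteqP; split.
- rewrite [X in measurable X](_ : _ = set0)//; by apply/seteqP; split.
- rewrite [X in measurable X](_ : _ = set0)//; by apply/seteqP; split.
pose f u j := flip (+) lagged_vote (M * d.+1) j u.
pose n := ((size l).+1 * d.+1)%N.
have [/andP[/eqP dd' /eqP bn]|ndb] := boolP ((d == d') && (size b == n)); last first.
  rewrite [X in measurable X](_ : _ = set0)//; apply/seteqP; split=> // u /= [dd' bE _].
  by move: ndb; rewrite dd' -bE size_mkseq !eqxx.
rewrite [X in measurable X](_ : _ = \bigcap_(j in `I_n) [set u | f u j = nth false b j] `&`
    [set u | response flip M l u = p]).
  apply: measurableI => //; apply: bigcap_measurableType => j _.
  rewrite [X in measurable X](_ : _ = lagged_vote (M * d.+1) j @^-1` [set flip (+) nth false b j]).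
    by rewrite -[X in measurable X]setTI; exact: measurable_lagged_vote.
  apply/seteqP; split=> u /=; rewrite /f; first by move=> <-; rewrite addbA addbb.
  by move=> ->; rewrite addbA addbb.
apply/seteqP; split=> u /=.
  move=> [_ bE pE]; split=> // j /= jn; by rewrite -bE (nth_mkseq _ _ jn).
move=> [bE ->]; rewrite -dd'.
suff -> : mkseq (f u) n = b by [].
apply: (@eq_from_nth _ false); first by rewrite size_mkseq.
by move=> j; rewrite size_mkseq => jn; rewrite nth_mkseq//; exact: bE.
Qed.

(** Measurable because it is a function of finitely many measurable votes; its
    reaction times are the multiples of a common lower bound of the block
    lengths. *)
Lemma response_strategy flip M l : (0 < M)%N ->
  is_strategy (fun u => play M (response flip M l u)).
Proof.
move=> M0; split.
  move=> _ Y mY; rewrite setTI [X in measurable X](_ : _ =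
      \bigcup_(p in [set p | p \in plans l] `&` [set p | Y (play M p)])
        [set u | response flip M l u = p]); last first.
    apply/seteqP; split=> u /=.
      by move=> Yu; exists (response flip M l u) => //=; split=> //;
         exact: response_in_plans.
    by move=> [p [_ Yp] ->].
  apply: fin_bigcup_measurable => [|p _]; last exact: measurable_response.
  by apply: finite_setIl; exact: finite_seq.
pose N := (M * (\sum_(d <- l) d).+1)%N.
have N0 : (0 < N)%N by rewrite muln_gt0 M0.
have hl d : d \in l -> N%:R^-1 * (M * d.+1)%:R <= 1 :> R.
  move=> dl; rewrite mulrC ler_pdivrMr ?ltr0n// mul1r ler_nat leq_mul2l ltnS.
  by rewrite (big_rem d)//= leq_addr orbT.
exists (fun n => n%:R / N%:R); split.
- by rewrite mul0r.
- by move=> n; rewrite ltr_pM2r ?invr_gt0 ?ltr0n// ltr_nat.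
- apply/cvgryPge => A; near=> n; rewrite ler_pdivlMr ?ltr0n//.
  by near: n; exact: nbhs_infty_ger.
- move=> n u v uv; apply: agree_upto_open.
  apply: (@filterS2 _ _ (ae_filter_ringOfSetsType lam) _ _ _ _
    (playE M (response flip M l u)) (playE M (response flip M l v))).
  move=> t pu pv /andP[t0 tn]; rewrite pu// pv//.
  apply: response_delay uv => //; first exact: hl.
  by rewrite t0/= ltW// (lt_le_trans tn)// -natr1 mulrDl mul1r.
Unshelve. all: by end_near. Qed.

End plans.

(** * Phases in which the opponent is blind *)

Section blind_phases.
Context (R : realType) (r : {posnum R}).
Context d (W : measurableType d) (P : probability W R).
Variable m : W * control r -> control r.
Hypothesis measurable_m : measurable_fun setT m.
Hypothesis m_strategy : {ae P, forall w, is_strategy (fun u => m (w, u))}.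
Implicit Types (w : W) (M k n j : nat) (p : plan).

(** The draws for which the opponent's play up to the end of phase [k] is a function
    of the plan before phase [k].  The delays of a draw need not depend
    measurably on it, so the absence of a reaction time in the phase may fail to
    be an event; this consequence of it, tested on countably many plans and
    votes, is one. *)
Definition blind M k : set W := [set w | forall p p',
  agree_upto (k%:R / M%:R) (play r M p) (play r M p') ->
  forall n j, (0 < n)%N -> j.+1%:R <= k.+1%:R / M%:R * n%:R :> R ->
  vote n j (m (w, play r M p)) = vote n j (m (w, play r M p'))].

Lemma measurable_reply v : measurable_fun setT (fun w => m (w, v)).
Proof. exact: measurable_fun_pair1. Qed.

Lemma measurable_blind M k : measurable (blind M k).
Proof.
have mvote n j v : measurable [set w | vote n j (m (w, v))].
  have := measurableT_comp (measurable_vote n j) (measurable_reply v).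
  by move=> /(_ measurableT [set true] I); rewrite setTI.
pose S (i : plan * plan * (nat * nat)) : set W := [set w |
  agree_upto (k%:R / M%:R) (play r M i.1.1) (play r M i.1.2) ->
  (0 < i.2.1)%N -> i.2.2.+1%:R <= k.+1%:R / M%:R * i.2.1%:R :> R ->
  vote i.2.1 i.2.2 (m (w, play r M i.1.1)) = vote i.2.1 i.2.2 (m (w, play r M i.1.2))].
have mS i : measurable (S i).
  have [H|nH] := pselect (agree_upto (k%:R / M%:R) (play r M i.1.1) (play r M i.1.2) /\
     (0 < i.2.1)%N /\ i.2.2.+1%:R <= k.+1%:R / M%:R * i.2.1%:R :> R); last first.
    rewrite (_ : S i = setT)//; apply/seteqP; split=> // w _ /= a b c.
    by exfalso; apply: nH.
  rewrite (_ : S i =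
     ([set w | vote i.2.1 i.2.2 (m (w, play r M i.1.1))] `&`
      [set w | vote i.2.1 i.2.2 (m (w, play r M i.1.2))]) `|`
     (~` [set w | vote i.2.1 i.2.2 (m (w, play r M i.1.1))] `&`
      ~` [set w | vote i.2.1 i.2.2 (m (w, play r M i.1.2))])).
    by apply: measurableU; apply: measurableI => //; exact: measurableC.
  case: H => H1 [H2 H3]; apply/seteqP; split=> w /=.
    move=> /(_ H1 H2 H3) ->; case: (vote _ _ _); [by left|right; by split].
  move=> H _ _ _; case: H => -[]; first by move=> -> ->.
  by move=> /negP/negPf -> /negP/negPf ->.
rewrite (_ : blind M k = ~` \bigcup_i ~` S i).
  apply: measurableC; apply: countable_bigcupT_measurable.
    exact: countableP.
  by move=> i; exact: measurableC.
rewrite setC_bigcup; apply/seteqP; split=> w /=.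
  by move=> bw i _; rewrite setCK => a b c; exact: bw.
move=> bw p p' a n j n0 jk.
by have := bw (p, p', (n, j)) I; rewrite setCK; exact.
Qed.

Lemma sum_eq_le1 (N a : nat) : (\sum_(k < N) (a == k) <= 1)%N.
Proof.
suff -> : (\sum_(k < N) (a == k) = (a < N))%N by exact: leq_b1.
elim: N => [|N IH]; first by rewrite big_ord0.
by rewrite big_ord_recr/= IH ltnS [(a <= N)%N]leq_eqVlt; case: ltngtP.
Qed.

(** A phase that is not blind contains a reaction time in its interior, and the
    number [q] of reaction times before [T] does not depend on [M]. *)
Lemma few_sighted_phases (T : nat) w : is_strategy (fun u => m (w, u)) ->
  exists q : nat, forall M, (0 < M)%N ->
    \sum_(k < T * M) \1_(~` blind M k) w <= q%:R :> R.
Proof.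
move=> [_ [t [t0 tlt tinf tdelay]]].
have [q _ /(_ q (leqnn q)) Tq] : \forall n \near \oo, T%:R <= t n.
  by move/cvgryPge : tinf; exact.
exists q.+1 => M M0.
have M0' : 0 < M%:R :> R by rewrite ltr0n.
have key (k : 'I_(T * M)) : \1_(~` blind M k) w <=
    (\sum_(i < q.+1) (Num.truncn (t i * M%:R) == k))%N%:R :> R.
  rewrite indicE; case: (boolP (_ \in _)) => [|_]; last by rewrite ler0n.
  rewrite inE => nb; rewrite ler_nat lt0n sum_nat_eq0; apply/negP.
  move=> /forallP avoid; apply: nb => p p' pp' n j n0 jk.
  have ex_i : exists i, k%:R < t i * M%:R.
    exists q; apply: lt_le_trans (ler_wpM2r (ltW M0') Tq).
    by rewrite -natrM ltr_nat.
  (* t i.+1 is the first reaction time after the start of phase k. *)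
  case: (ex_minnP ex_i) => -[|i]; first by rewrite t0 mul0r ltNge ler0n.
  move=> ki imin.
  have iq : (i.+1 <= q)%N.
    apply: imin; apply: lt_le_trans (ler_wpM2r (ltW M0') Tq).
    by rewrite -natrM ltr_nat.
  have ik : t i <= k%:R / M%:R.
    rewrite ler_pdivlMr// leNgt; apply/negP => /imin; by rewrite ltnn.
  have ki1 : k.+1%:R / M%:R <= t i.+1.
    have ti0 : 0 <= t i.+1 * M%:R by apply: le_trans (ltW ki).
    rewrite ler_pdivrMr// -truncn_ge_nat//.
    rewrite ltn_neqAle truncn_ge_nat// (ltW ki) andbT.
    have iq1 : (i.+1 < q.+1)%N by [].
    by have := avoid (Ordinal iq1); rewrite eqb0 /= eq_sym.
  apply: (vote_agree n0 jk); apply: (agree_upto_le ki1); apply: tdelay.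
  exact: agree_upto_le pp'.
apply: le_trans (ler_sum _ (fun k : 'I_(T * M) => fun _ => key k)) _.
rewrite -natr_sum ler_nat exchange_big/=.
apply: (@leq_trans (\sum_(i < q.+1) 1)); last by rewrite sum1_card card_ord.
by apply: leq_sum => i _; exact: sum_eq_le1.
Qed.

(** Boundedly many phases out of [T * M], each of length [1 / M]. *)
Lemma sighted_phases_negligible (T : nat) (eta : R) : 0 < eta ->
  exists2 M, (0 < M)%N &
    (\sum_(k < T * M) (M%:R^-1)%:E * P (~` blind M k) < eta%:E)%E.
Proof.
move=> eta0.
pose f M w : \bar R := (\sum_(k < T * M.+1) (M.+1%:R^-1)%:E *
  (\1_(~` blind M.+1 k) w)%:E)%E.
have mC M k : measurable (~` blind M k) by apply: measurableC; exact: measurable_blind.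
have mf1 M (k : nat) : measurable_fun setT
    (fun w => (M.+1%:R^-1)%:E * (\1_(~` blind M.+1 k) w)%:E : \bar R)%E.
  apply: emeasurable_funM => //; apply/measurable_EFinP.
  exact: measurable_indic.
have fE M w : f M w = (M.+1%:R^-1 * \sum_(k < T * M.+1) \1_(~` blind M.+1 k) w)%:E.
  rewrite /f mulr_sumr -sumEFin; apply: eq_bigr => k _; by rewrite EFinM.
have fint M : (\int[P]_w f M w =
    \sum_(k < T * M.+1) (M.+1%:R^-1)%:E * P (~` blind M.+1 k))%E.
  rewrite ge0_integral_sum//.
  apply: eq_bigr => k _; rewrite ge0_integralZl_EFin//.
  - by rewrite integral_indic// setIT.
  - by apply/measurable_EFinP; exact: measurable_indic.
have : (\int[P]_w f M w @[M --> \oo] --> 0)%E.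
  apply: (@bounded_cvg0 _ _ _ _ _ T%:R).
  - by move=> M; apply: emeasurable_sum => k; exact: mf1.
  - move=> M w; rewrite fE !lee_fin mulr_ge0 ?invr_ge0 ?sumr_ge0//=.
    rewrite ler_pdivrMl ?ltr0n// [leRHS]mulrC -natrM.
    rewrite (@le_trans _ _ (\sum_(k < T * M.+1) 1))//.
      by apply: ler_sum => k _; rewrite indicE; case: (_ \in _).
    by rewrite sumr_const card_ord.
  - apply: filterS m_strategy => w /(few_sighted_phases T)[q qP].
    apply: (@squeeze_cvge _ _ _ _ (cst 0%E) _ (fun M => (M.+1%:R^-1 * q%:R)%:E)).
    + apply: nearW => M; rewrite fE !lee_fin mulr_ge0 ?invr_ge0 ?sumr_ge0//=.
      by rewrite ler_pM2l ?invr_gt0 ?ltr0n//; exact: qP.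
    + exact: cvg_cst.
    + apply: cvg_EFin; first exact: nearW.
      rewrite -[X in _ --> X](mul0r q%:R).
      by apply: cvgM; [exact: cvg_harmonic|exact: cvg_cst].
move=> /(_ _ (open_ereal_lt' _)) => /(_ eta%:E); rewrite lte_fin => /(_ eta0).
case=> M _ /(_ M (leqnn M)) /=; rewrite fint => fM.
by exists M.+1.
Qed.

End blind_phases.

(** * Expected prediction errors *)

Section regret.
Context (R : realType) (r : {posnum R}).
Local Notation lam := (@lebesgue_measure R).
Local Notation nu := (clock r).
Context d (W : measurableType d) (P : probability W R).
Variable m : W * control r -> control r.
Hypothesis measurable_m : measurable_fun setT m.
Implicit Types (w : W) (M k n j : nat) (p : plan) (l : seq nat).

(** An upper bound of the prediction errors for a given draw, whatever the play
    induced by it: a sighted phase is lost entirely, and in a blind phase the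
    errors against all possible earlier plans are added up, one of which is the
    actual plan. *)
Fixpoint regret M l w : \bar R :=
  if l is e :: l' then
    (regret M l' w + ((r%:num / M%:R)%:E * (\1_(~` blind m M (size l')) w)%:E
     + \sum_(p <- plans l') phase_loss M e.+1 (size l') (m (w, play r M p))))%E
  else 0%E.

Lemma measurable_loss M e k p :
  measurable_fun setT (fun w => phase_loss M e k (m (w, play r M p))).
Proof.
exact: (measurableT_comp (measurable_phase_loss M e k) (measurable_reply measurable_m _)).
Qed.

Lemma measurable_penalty M k : measurable_fun setT
  (fun w => ((r%:num / M%:R)%:E * (\1_(~` blind m M k) w)%:E : \bar R)%E).
Proof.
apply: emeasurable_funM => //; apply/measurable_EFinP; apply: measurable_indic.
by apply: measurableC; exact: measurable_blind.
Qed.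

Lemma penalty_ge0 M k w :
  (0 <= (r%:num / M%:R)%:E * (\1_(~` blind m M k) w)%:E :> \bar R)%E.
Proof. by rewrite mule_ge0 ?lee_fin// divr_ge0. Qed.

Lemma losses_ge0 M e k (s : seq plan) w :
  (0 <= \sum_(p <- s) phase_loss M e k (m (w, play r M p)))%E.
Proof. by apply: sume_ge0 => p _; exact: phase_loss_ge0. Qed.

Lemma regret_ge0 M l w : (0 <= regret M l w)%E.
Proof.
elim: l => //= e l IH; apply: adde_ge0 => //.
by apply: adde_ge0; [exact: penalty_ge0|exact: losses_ge0].
Qed.

Lemma measurable_losses M e k (s : seq plan) : measurable_fun setT
  (fun w => \sum_(p <- s) phase_loss M e k (m (w, play r M p)))%E.
Proof. by apply: emeasurable_sum => p; exact: measurable_loss. Qed.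

Lemma measurable_regret M l : measurable_fun setT (regret M l).
Proof.
elim: l => [|e l IH] /=; first exact: measurable_cst.
apply: emeasurable_funD => //; apply: emeasurable_funD.
  exact: measurable_penalty.
exact: measurable_losses.
Qed.

Lemma losses_cvg0 M k (s : seq plan) : (0 < M)%N ->
  (\int[P]_w (\sum_(p <- s) phase_loss M e.+1 k (m (w, play r M p))))%E
    @[e --> \oo] --> 0%E.
Proof.
move=> M0.
rewrite (_ : (fun e => _) = (fun e => \sum_(p <- s)
    \int[P]_w phase_loss M e.+1 k (m (w, play r M p)))%E); last first.
  apply/funext => e; rewrite ge0_integral_sum//.
    by move=> p; exact: measurable_loss.
  by move=> p w _; exact: phase_loss_ge0.
rewrite [X in _ --> X](_ : _ = \sum_(p <- s) (0 : \bar R))%E; last by rewrite big1.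
apply: (@cvg_nnesum _ _ _ _ _ s (fun p e =>
    \int[P]_w phase_loss M e.+1 k (m (w, play r M p)))%E (fun=> 0%E) xpredT) => p _.
  by apply: nearW => e; apply: integral_ge0 => w _; exact: phase_loss_ge0.
apply: (@bounded_cvg0 _ _ _ _ _ 1%R).
- by move=> e; exact: measurable_loss.
- move=> e w; rewrite phase_loss_ge0/=; apply: phase_loss_le1.
  by rewrite muln_gt0 M0.
- by apply: aeW => w; exact: phase_loss_cvg0.
Qed.

(** The block length of a phase is chosen after those of the earlier phases,
    which determine the finite list of plans to be taken into account. *)
Lemma small_regret M K (eta : R) : (0 < M)%N -> 0 < eta ->
  exists2 l, size l = K &
    (\int[P]_w regret M l w <= \sum_(k < K)
      ((r%:num / M%:R)%:E * P (~` blind m M k) + eta%:E))%E.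
Proof.
move=> M0 eta0; elim: K => [|K [l lK IH]].
  by exists [::] => //=; rewrite integral0 big_ord0.
have := losses_cvg0 K (plans l) M0.
move=> /(_ _ (open_ereal_lt' _)) => /(_ eta%:E); rewrite lte_fin => /(_ eta0).
case=> e _ /(_ e (leqnn e)) /= small.
exists (e :: l) => /=; first by rewrite lK.
rewrite ge0_integralD//; last 4 first.
- by move=> w _; exact: regret_ge0.
- exact: measurable_regret.
- by move=> w _; apply: adde_ge0; [exact: penalty_ge0|exact: losses_ge0].
- by apply: emeasurable_funD; [exact: measurable_penalty|exact: measurable_losses].
rewrite big_ord_recr/= leeD//.
rewrite ge0_integralD; last 5 first.
- exact: measurableT.
- by move=> w _; exact: penalty_ge0.
- exact: measurable_penalty.
- by move=> w _; exact: losses_ge0.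
- exact: measurable_losses.
have mC : measurable (~` blind m M K).
  by apply: measurableC; exact: measurable_blind.
rewrite lK ge0_integralZl_EFin ?divr_ge0//; last first.
  by apply/measurable_EFinP; exact: measurable_indic.
by rewrite integral_indic// setIT leeD// ltW.
Qed.

Definition mistakes (flip : bool) (x y : control r) : set (measurableTypeR R) :=
  [set t | x t != flip (+) y t].

Lemma measurable_mistakes flip x y : measurable (mistakes flip x y).
Proof.
apply: (@measurable_bset R); have mx := measurable_control x.
have my := measurable_control y.
rewrite (_ : (fun t => _) = (fun t => if x t then
    (if flip then y t else ~~ y t) else (if flip then ~~ y t else y t))).
  by apply: measurable_fun_ifT => //; case: flip => //; apply: measurable_neg.
by apply/funext => t; case: flip (x t) (y t) => -[] [].
Qed.

Lemma clock_itv (a b : R) : a <= b ->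
  (nu `[a, b[%classic <= (r%:num * (b - a))%:E)%E.
Proof.
move=> ab; apply: le_trans (clock_le_lebesgue _ _) _ => //.
rewrite lebesgue_measure_itv/= lte_fin.
case: ifP => _; first by rewrite -EFinB -EFinM.
by rewrite mule0 lee_fin mulr_ge0// subr_ge0.
Qed.

(** The plan is required to follow the strategy only until the end of the last
    phase of [l], so that the induction on phases applies to the same play.  In a
    blind phase the opponent's play is unchanged if the responder's plan is
    truncated at the start of the phase; the truncated plan is one of
    [plans l]. *)
Lemma regret_bound flip M l w x p : (0 < M)%N ->
  m (w, play r M p) = x ->
  agree_upto ((size l)%:R / M%:R) (play r M p) (play r M (response flip M l x)) ->
  (nu (`[0%R, ((size l)%:R / M%:R)%R[ `&` mistakes flip x (play r M p)) <= regret M l w)%E.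
Proof.
move=> M0 xE; have M0' : 0 < M%:R :> R by rewrite ltr0n.
set y := play r M p; elim: l => [|e l IH] yx.
  rewrite /= mul0r (_ : `[0%R, 0%R[%classic = set0) ?set0I ?measure0//.
  by apply/seteqP; split=> t //=; rewrite in_itv/= => /andP[t0 /(le_lt_trans t0)]; rewrite ltxx.
set k := size l in IH yx *; set l' := e :: l in yx *.
have kk : k%:R / M%:R <= k.+1%:R / M%:R :> R by rewrite ler_pM2r ?invr_gt0// ler_nat.
have old : agree_upto (k%:R / M%:R) y (play r M (response flip M l x)).
  apply: agree_upto_open.
  apply: (@filterS3 _ _ (ae_filter_ringOfSetsType lam) _ _ _ _ _ yx
    (playE r M (response flip M l' x)) (playE r M (response flip M l x))).
  move=> t yt p1 p2 /andP[t0 tk]; rewrite yt ?p1 ?p2//; last first.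
    by rewrite /= in_itv/= t0/= (le_trans (ltW tk)).
  by rewrite /= size_response -ltr_pdivlMr// tk.
have mD := measurable_mistakes flip x y.
have split_le : (nu (`[0%R, (k.+1%:R / M%:R)%R[ `&` mistakes flip x y) <=
   nu (`[0%R, (k%:R / M%:R)%R[ `&` mistakes flip x y) +
   nu (`[(k%:R / M%:R)%R, (k.+1%:R / M%:R)%R[ `&` mistakes flip x y))%E.
  have m1 : measurable (`[0%R, (k%:R / M%:R)%R[ `&` mistakes flip x y).
    exact: measurableI.
  have m2 : measurable (`[(k%:R / M%:R)%R, (k.+1%:R / M%:R)%R[ `&` mistakes flip x y).
    exact: measurableI.
  apply: (@le_trans _ _ _ _ _ _ (measureU2 nu m1 m2)).
  apply: (le_measure nu); rewrite ?inE; [exact: measurableI|exact: measurableU|].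
  move=> t [+ tD]; rewrite [X in X -> _]/= in_itv/= => /andP[t0 tk1].
  have [tk|kt] := ltP t (k%:R / M%:R); [left|right]; (split; last exact: tD);
    by rewrite /= in_itv/= ?t0 ?kt.
apply: (le_trans split_le); rewrite /= leeD//; first exact: IH old.
rewrite -/k; have [wb|wb] := pselect (blind m M k w); last first.
  rewrite indicE mem_set// mule1.
  apply: (@le_trans _ _ (r%:num / M%:R)%:E); last first.
    by rewrite leeDl// losses_ge0.
  apply: (@le_trans _ _ (nu `[(k%:R / M%:R)%R, (k.+1%:R / M%:R)%R[%classic)).
    by apply: (le_measure nu); rewrite ?inE; [exact: measurableI| |move=> t []].
  rewrite (le_trans (clock_itv kk))// lee_fin -mulrBl -natrB// subSnn mul1r.
  by [].
rewrite indicE memNset; last by move/(_ wb).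
rewrite mule0 add0e.
pose q := response flip M l x; pose x' := m (w, play r M q).
pose n := (M * e.+1)%N.
have n0 : (0 < n)%N by rewrite muln_gt0 M0.
have xx' : agree_upto (k.+1%:R / M%:R) x x'.
  apply: agree_of_votes => n' j n'0 jk; rewrite -xE; exact: wb.
apply: (@le_trans _ _ (phase_loss M e.+1 k x')); last first.
  rewrite (big_rem q (response_in_plans _ _ _ _))/=.
  by rewrite leeDl// losses_ge0.
(* The phase boundary a / M is the point a * e.+1 of the grid of this phase. *)
have gridE a : a%:R / M%:R * n%:R = (a * e.+1)%:R :> R.
  by rewrite /n natrM mulrA divfK ?gt_eqF// natrM.
have jk (i : 'I_e.+1) : (k * e.+1 + i).+1%:R <= k.+1%:R / M%:R * n%:R :> R.
  by rewrite gridE ler_nat mulSn addnC ltn_add2r ltn_ord.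
have -> : phase_loss M e.+1 k x' = phase_loss M e.+1 k x.
  apply: eq_bigr => i _ /=; rewrite -/n; set j := (k * e.+1 + i)%N.
  have lv : lagged_vote n j x = lagged_vote n j x'.
    have := jk i; rewrite -/j; case: (j) => [|[|j']]//= jk'.
    apply: vote_agree xx' => //; rewrite (le_trans _ jk')// ler_nat.
    by rewrite !ltnS; exact: leqW.
  rewrite -lv; apply/esym; apply: miss_agree xx'; first exact: measurable_block.
  move=> t; rewrite /block/= !in_itv/= => /andP[jt tj].
  rewrite (le_trans _ jt)//= ltW// (lt_le_trans tj)//.
  by rewrite ler_pdivrMr ?ltr0n//; exact: jk.
have [N [mN N0 NP]] : {ae lam, forall t, k%:R / M%:R <= t < k.+1%:R / M%:R ->
    y t = flip (+) lagged_vote n (Num.truncn (t * n%:R)) x}.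
  apply: (@filterS2 _ _ (ae_filter_ringOfSetsType lam) _ _ _ _ yx
    (playE r M (response flip M l' x))).
  move=> t yt pt /andP[kt tk1].
  have t0 : 0 <= t by rewrite (le_trans _ kt)// divr_ge0.
  rewrite yt; last by rewrite /= in_itv/= t0/= ltW.
  rewrite pt// response_now// -ler_pdivrMr// -ltr_pdivlMr//.
  by rewrite kt.
(* The mistakes of the phase are the wrong lagged votes, block by block. *)
pose F i := block n (k * e.+1 + i) `&`
  [set t | x t != lagged_vote n (k * e.+1 + i) x].
have mF i : measurable (F i).
  by apply: measurableI; [exact: measurable_block|exact: measurable_differ].
have -> : phase_loss M e.+1 k x = (\sum_(i < e.+1) nu (F i))%E by [].
apply: (@le_trans _ _ (nu (\big[setU/set0]_(i < e.+1) F i))); last first.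
  by apply: Boole_inequality => i _; exact: mF.
have mUF : measurable (\big[setU/set0]_(i < e.+1) F i).
  by apply: bigsetU_measurable => i _; exact: mF.
rewrite -[leRHS]adde0 -(clock_null r mN N0).
apply: (@le_trans _ _ _ _ _ _ (measureU2 nu mUF mN)).
apply: (le_measure nu); rewrite ?inE; [exact: measurableI|exact: measurableU|].
move=> t [/=]; rewrite in_itv/= => /andP[kt tk1] xy.
have [Nt|Nt] := pselect (N t); [by right|left].
have yt : y t = flip (+) lagged_vote n (Num.truncn (t * n%:R)) x.
  by apply: contrapT => yt; apply/Nt/NP => /=; rewrite kt tk1 => /(_ isT).
have t0 : 0 <= t by rewrite (le_trans _ kt)// divr_ge0.
have tj := block_truncn n0 t0.
move: xy yt tj; rewrite /mistakes/= => xy yt.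
move: xy; rewrite yt addbA addbb addFb.
have lej : (k * e.+1 <= Num.truncn (t * n%:R))%N.
  by rewrite truncn_ge_nat ?mulr_ge0// -(gridE k) ler_wpM2r.
have ltj : (Num.truncn (t * n%:R) < k * e.+1 + e.+1)%N.
  by rewrite -mulSnr truncn_lt_nat ?mulr_ge0// -(gridE k.+1) ltr_pM2r ?ltr0n.
move=> xt tj; rewrite -(bigcup_mkord e.+1 F).
exists (Num.truncn (t * n%:R) - k * e.+1)%N => /=.
  by rewrite ltn_subLR.
by rewrite /F subnKC.
Qed.

End regret.

(** * A nearly perfect response and its equilibrium *)

Section near_perfect_response.
Context (R : realType) (r : {posnum R}).
Local Notation lam := (@lebesgue_measure R).
Local Notation nu := (clock r).
Context d (W : measurableType d) (P : probability W R).
Variable m : W * control r -> control r.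
Hypothesis measurable_m : measurable_fun setT m.
Hypothesis m_strategy : {ae P, forall w, is_strategy (fun u => m (w, u))}.
Implicit Types (u v : control r) (w : W) (M : nat) (p : plan) (l : seq nat).

Lemma response_nonanticipative flip M l s u v : (0 < M)%N -> agree_upto s u v ->
  agree_upto s (play r M (response flip M l u)) (play r M (response flip M l v)).
Proof.
move=> M0 uv; apply: agree_upto_open.
apply: (@filterS2 _ _ (ae_filter_ringOfSetsType lam) _ _ _ _
  (playE r M (response flip M l u)) (playE r M (response flip M l v))).
move=> t pu pv /andP[t0 ts]; rewrite pu// pv//.
apply: (@response_delay _ _ _ _ _ _ _ s 0) => //.
by rewrite t0/= addr0 ltW.
Qed.

Lemma response_eq flip M l u v : (0 < M)%N ->
  agree_upto ((size l)%:R / M%:R)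
    (play r M (response flip M l u)) (play r M (response flip M l v)) ->
  play r M (response flip M l u) = play r M (response flip M l v).
Proof.
move=> M0 uv; apply/control_eqP.
apply: (@filterS3 _ _ (ae_filter_ringOfSetsType lam) _ _ _ _ _ uv
  (playE r M (response flip M l u)) (playE r M (response flip M l v))).
move=> t tuv pu pv; rewrite /= in_itv/= andbT => t0.
have [tl|lt] := leP t ((size l)%:R / M%:R).
  by apply: tuv; rewrite /= in_itv/= t0.
have M0' : 0 < M%:R :> R by rewrite ltr0n.
by rewrite pu// pv// !response_after// -ler_pdivrMr// ltW.
Qed.

(** Iterate the two strategies on an arbitrary plan.  By the delays of the opponent
    consecutive iterates agree up to the [i]-th reaction time, and a response is
    constant after its last phase, so the iteration becomes stationary. *)
Lemma equilibrium_plan flip M l w : (0 < M)%N -> is_strategy (fun u => m (w, u)) ->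
  exists2 p, p \in plans l &
    play r M (response flip M l (m (w, play r M p))) = play r M p.
Proof.
move=> M0 [_ [t [t0 _ tinf tdelay]]].
pose p := fix p i : plan :=
  if i is i'.+1 then response flip M l (m (w, play r M (p i'))) else [::].
have agree i : agree_upto (t i) (play r M (p i)) (play r M (p i.+1)).
  elim: i => [|i IH].
    rewrite t0; apply: agree_upto_open; apply: aeW => s /andP[s0 /(le_lt_trans s0)].
    by rewrite ltxx.
  exact: response_nonanticipative (tdelay _ _ _ IH).
have [N _ /(_ N.+1 (leqnSn N)) TN] :
    \forall n \near \oo, (size l)%:R / M%:R <= t n.
  by move/cvgryPge : tinf; exact.
exists (p N.+1); first exact: response_in_plans.
by apply/esym/response_eq => //; exact: agree_upto_le TN (agree N.+1).
Qed.

(** A search in a finite list instead of the limit of the iteration: each test is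
    an event, so the result is measurable. *)
Fixpoint first_equilibrium flip M l (s : seq plan) w : control r :=
  if s is p :: s' then
    if play r M (response flip M l (m (w, play r M p))) == play r M p
    then play r M p else first_equilibrium flip M l s' w
  else play r M [::].

Lemma measurable_first_equilibrium flip M l s : (0 < M)%N ->
  measurable_fun setT (first_equilibrium flip M l s).
Proof.
move=> M0; elim: s => [|p s IH] /=; first exact: measurable_cst.
apply: measurable_fun_ifT => //.
have mX : measurable_fun setT
    (fun w => play r M (response flip M l (m (w, play r M p)))).
  have [mS _] := response_strategy r flip l M0.
  exact: (measurableT_comp mS (measurable_reply measurable_m _)).
move=> _; apply: (measurable_fun_bool true) => //.
rewrite setTI [X in measurable X](_ : _ =
  [set w | play r M (response flip M l (m (w, play r M p))) = play r M p]).
  exact: measurable_fiber.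
by apply/seteqP; split=> w /= /eqP.
Qed.

Lemma first_equilibriumP flip M l s w :
  (exists2 p, p \in s & play r M (response flip M l (m (w, play r M p))) = play r M p) ->
  play r M (response flip M l (m (w, first_equilibrium flip M l s w))) =
    first_equilibrium flip M l s w.
Proof.
elim: s => [[p]//|q s IH [p]]; rewrite inE => /predU1P[->|ps] pE /=.
  by rewrite pE eqxx.
by case: eqP => // _; apply: IH; exists p.
Qed.

Lemma regret_total flip M T l w y : (0 < M)%N -> size l = (T * M)%N ->
  play r M (response flip M l (m (w, y))) = y ->
  (nu (mistakes flip (m (w, y)) y) <= regret m M l w + nu `[T%:R, +oo[%classic)%E.
Proof.
move=> M0 lT yE; set x := m (w, y) in yE *.
have M0' : 0 < M%:R :> R by rewrite ltr0n.
have sl : (size l)%:R / M%:R = T%:R :> R by rewrite lT natrM mulfK ?gt_eqF.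
have := regret_bound (flip := flip) (m := m) (l := l) (w := w) (x := x)
  (p := response flip M l x) M0.
rewrite yE sl => /(_ erefl (aeW _ (fun _ _ => erefl))) early.
apply: le_trans (leeD early (lexx _)).
have mD := measurable_mistakes flip x y.
have mE : measurable (`[0%R, (T%:R : R)[ `&` mistakes flip x y) by exact: measurableI.
have mL : measurable (`[(T%:R : R), +oo[%classic : set (measurableTypeR R)) by [].
have mN : measurable (`]-oo, (0 : R)[%classic : set (measurableTypeR R)) by [].
rewrite -[leRHS]adde0 -(clock_neg r).
apply: le_trans (leeD (measureU2 nu mE mL) (lexx _)).
apply: (@le_trans _ _ _ _ _ _ (measureU2 nu (measurableU _ _ mE mL) mN)).
apply: (le_measure nu); rewrite ?inE; [exact: mD| |].
  by apply: measurableU => //; exact: measurableU.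
move=> t tD; have [t0|t0] := ltP t 0; [right|left]; first by rewrite /= in_itv.
have [tT|Tt] := ltP t T%:R; [left|right]; last by rewrite /= in_itv/= Tt.
by split=> //; rewrite /= in_itv/= t0.
Qed.

(** [Y] provides an induced play, and [F] bounds the errors of every induced play,
    whichever of them the expected payoff refers to. *)
Lemma near_perfect_response flip (eps : R) : 0 < eps ->
  exists (s : strategy r) (Y : W -> control r) (F : W -> \bar R),
  [/\ measurable_fun setT Y,
      {ae P, forall w, s (m (w, Y w)) = Y w},
      measurable_fun setT F,
      (forall w, 0 <= F w)%E &
      (\int[P]_w F w < eps%:E)%E /\
      forall w y, s (m (w, y)) = y ->
        (nu (mistakes flip (m (w, y)) y) <= F w)%E].
Proof.
move=> eps0.
(* Three errors of eps / 4: late times, sighted phases and blind phases. *)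
have e4 : (0%:E < (eps / 4)%:E)%E by rewrite lte_fin divr_gt0.
have [T late] : exists T : nat, (nu `[T%:R, +oo[%classic < (eps / 4)%:E)%E.
  have late0 : nu `[n%:R, +oo[%classic @[n --> \oo] --> 0%E.
    apply: measure_cvg0 => //; apply: aeW => t; near=> n.
    rewrite /= in_itv/= andbT; apply/negP; rewrite -ltNge.
    by near: n; exact: nbhs_infty_gtr.
  have [T _ /(_ T (leqnn T)) ?] := late0 _ (open_ereal_lt' e4).
  by exists T.
have [M M0 sighted] := sighted_phases_negligible measurable_m m_strategy T
  (divr_gt0 eps0 (mulr_gt0 (ltr0Sn R 3) (gt0 r))).
pose K := (T * M)%N; pose eta := eps / 4 / K.+1%:R.
have eta0 : 0 < eta by rewrite !divr_gt0.
have [l lK small] := small_regret P measurable_m K M0 eta0.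
pose s := Strategy (response_strategy r flip l M0).
exists s, (first_equilibrium flip M l (plans l)),
  (fun w => regret m M l w + nu `[T%:R, +oo[%classic)%E.
have mR := measurable_regret measurable_m M l.
split=> //.
- exact: measurable_first_equilibrium.
- apply: filterS m_strategy => w mw; apply: first_equilibriumP.
  exact: equilibrium_plan.
- exact: emeasurable_funD.
- by move=> w; rewrite adde_ge0// regret_ge0.
split; last by move=> w y; exact: regret_total.
rewrite ge0_integralD//; last by move=> w _; exact: regret_ge0.
move: (nu _) late => late_part late.
rewrite integral_cst// [X in (late_part * X)%E](_ : _ = 1%E) ?mule1; last first.
  exact: probability_setT.
have small2 : (\int[P]_w regret m M l w <= (eps / 4 + eps / 4)%:E)%E.
  apply: (le_trans small); rewrite big_split/= EFinD leeD//.
    rewrite (_ : (\sum_(k < K) _)%E = (r%:num%:E *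
        \sum_(k < K) (M%:R^-1)%:E * P (~` blind m M k))%E); last first.
      rewrite ge0_sume_distrr//; first by apply: eq_bigr => k _; rewrite EFinM muleA.
      by move=> k _; rewrite mule_ge0// lee_fin.
    apply: le_trans (lee_wpmul2l _ (ltW sighted)) _; first by rewrite lee_fin.
    rewrite -EFinM lee_fin le_eqVlt; apply/orP; left; apply/eqP; field.
    by rewrite gt_eqF.
  rewrite sumEFin lee_fin sumr_const card_ord -[leLHS]mulr_natr /eta.
  rewrite -[leLHS]mulrA; apply: ler_piMr; first by rewrite divr_ge0 ?(ltW eps0).
  by rewrite mulrC ler_pdivrMr ?ltr0n// mul1r ler_nat.
apply: le_lt_trans (leeD small2 (ltW late)) _.
rewrite -EFinD lte_fin; lra.
Unshelve. all: by end_near. Qed.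

End near_perfect_response.

(** * From prediction errors to expected payoffs *)

Section expectation_bound.
Local Open Scope ereal_scope.
Context d (Z : measurableType d) (R : realType).

(** Immediate from the integral of a nonnegative function being a supremum over
    simple functions.  It applies in this form to the payoff of an induced play,
    which is a function of two controls jointly. *)
Lemma ge0_le_integral_nonmeasurable (Q : {measure set Z -> \bar R}) (f g : Z -> \bar R) :
  (forall z, 0 <= f z) -> (forall z, f z <= g z) ->
  \int[Q]_z f z <= \int[Q]_z g z.
Proof.
move=> f0 fg; rewrite !ge0_integralTE//; last first.
  by move=> z; exact: le_trans (fg z).
apply: ge_ereal_sup => _ [h /= hf <-]; apply: ereal_sup_ubound.
by exists h => //= z; exact: le_trans (fg z).
Qed.

(** The measurable function [G] below [V] is the positive part of [1 - F] outside a
    negligible set. *)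
Lemma integral_lower_bound (Q : probability Z R) (V F : Z -> \bar R) (eps : R) :
  measurable_fun setT F -> (forall z, 0 <= F z) -> (forall z, 0 <= V z) ->
  {ae Q, forall z, 1 <= V z + F z} ->
  \int[Q]_z F z < eps%:E -> (1 - eps)%:E < \int[Q]_z V z.
Proof.
move=> mF F0 V0 [N [mN N0 NP]] Feps.
pose G z := if z \in N then 0 else maxe 0 (1 - F z).
have mG : measurable_fun setT G.
  apply: measurable_fun_ifT.
  - move=> _; apply: (measurable_fun_bool true) => //.
    by rewrite setTI (_ : _ @^-1` _ = N)//; apply/seteqP; split=> z /=;
      [exact: set_mem|exact: mem_set].
  - exact: measurable_cst.
  - by apply: measurable_maxe => //; apply: emeasurable_funB.
have G0 z : 0 <= G z by rewrite /G; case: ifP => // _; rewrite le_max lexx.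
have GV z : G z <= V z.
  rewrite /G; case: ifPn => // /negP; rewrite in_setE => zN.
  rewrite ge_max V0/=.
  have : 1 <= V z + F z by apply: contrapT => zVF; apply/zN/NP.
  move: (F0 z); case: (F z) => [a| |]//; last by rewrite addeNy leNye.
  by move=> _; rewrite leeBlDr.
apply: lt_le_trans (ge0_le_integral_nonmeasurable Q G0 GV).
have : 1 <= \int[Q]_z G z + \int[Q]_z F z.
  rewrite -ge0_integralD//.
  have <- : \int[Q]_z cst 1 z = 1.
    rewrite integral_cst// mul1e; exact: probability_setT.
  apply: ae_ge0_le_integral => //.
  - by move=> z _; exact: adde_ge0.
  - exact: emeasurable_funD.
  - exists N; split=> // z /= H; apply: contrapT => zN; apply: H => _.
    rewrite /G ifF; last by apply/negP; rewrite in_setE.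
    move: (F0 z); case: (F z) => [a| |]// a0; last first.
      by rewrite addey ?leey// gt_eqF// (lt_le_trans _ (le_maxl _ _)).
    rewrite -[X in maxe _ X]EFinB; have [a1|a1] := leP a 1%R.
      by rewrite max_r ?lee_fin ?subr_ge0// subrK.
    by rewrite max_l ?add0e ?lee_fin ?subr_le0 ltW.
have F0' : 0 <= \int[Q]_z F z by exact: integral_ge0.
have [c cE] : exists c, \int[Q]_z F z = c%:E.
  exists (fine (\int[Q]_z F z)); rewrite fineK// ge0_fin_numE//.
  exact: lt_trans Feps (ltry _).
move: Feps; rewrite cE lte_fin => ceps.
rewrite -leeBlDr//; apply: lt_le_trans.
by rewrite -EFinB lte_fin ltrD2l ltrN2.
Qed.

End expectation_bound.

Section marginals.
Local Open Scope ereal_scope.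
Context d1 d2 (T1 : measurableType d1) (T2 : measurableType d2) (R : realType).
Variables (P1 : probability T1 R) (P2 : probability T2 R).

Lemma integral_fst (F : T1 -> \bar R) : measurable_fun setT F ->
  (forall x, 0 <= F x) -> \int[P1 \x P2]_z F z.1 = \int[P1]_x F x.
Proof.
move=> mF F0; rewrite fubini_tonelli1//; last first.
  exact: (measurableT_comp mF (@measurable_fst _ _ _ _)).
apply: eq_integral => x _; rewrite /fubini_F/= -/(cst (F x)) integral_cst//.
by rewrite [X in _ * X](_ : _ = 1) ?mule1//; exact: probability_setT.
Qed.

Lemma integral_snd (F : T2 -> \bar R) : measurable_fun setT F ->
  (forall x, 0 <= F x) -> \int[P1 \x P2]_z F z.2 = \int[P2]_x F x.
Proof.
move=> mF F0; rewrite fubini_tonelli2//; last first.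
  exact: (measurableT_comp mF (@measurable_snd _ _ _ _)).
apply: eq_integral => x _; rewrite /fubini_G/= -/(cst (F x)) integral_cst//.
by rewrite [X in _ * X](_ : _ = 1) ?mule1//; exact: probability_setT.
Qed.

Lemma ae_fst (A : set T1) : {ae P1, forall x, A x} ->
  {ae (P1 \x P2), forall z, A z.1}.
Proof.
move=> [N [mN N0 NA]]; exists (N `*` setT); split.
- exact: measurableX.
- by rewrite product_measure1E// [X in X * _]N0 mul0e.
- by move=> z /= Az; split=> //; exact: NA.
Qed.

Lemma ae_snd (A : set T2) : {ae P2, forall x, A x} ->
  {ae (P1 \x P2), forall z, A z.2}.
Proof.
move=> [N [mN N0 NA]]; exists (setT `*` N); split.
- exact: measurableX.
- by rewrite product_measure1E// [X in _ * X]N0 mule0.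
- by move=> z /= Az; split=> //; exact: NA.
Qed.

End marginals.

Section matching_pennies.
Context (R : realType) (r : {posnum R}).
Local Notation nu := (clock r).

Lemma payoff_mistakes i flip (u : control r * control r) (x y : control r) :
  (forall t, reward i (u.1 t) (u.2 t) = (x t == flip (+) y t)) ->
  ((payoff i u)%:E + nu (mistakes flip x y) = 1)%E.
Proof.
move=> uxy; have mD := measurable_mistakes flip x y.
rewrite payoffE (_ : [set t | _] = ~` mistakes flip x y); last first.
  apply/seteqP; split=> t; rewrite /mistakes/= uxy; first by move=> ->.
  by move/negP; rewrite negbK.
rewrite fineK; last by apply: fin_num_measure; exact: measurableC.
rewrite probability_setC// subeK//; exact: fin_num_measure.
Qed.

(** An induced play [U0] is needed only to exclude the default value of the
    expected payoff. *)
Lemma expected_payoff_gt i (ma mb : mixed_strategy r)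
    (F : mixed_space ma * mixed_space mb -> \bar R) (eps : R) U0 :
  measurable_fun setT F -> (forall z, 0 <= F z)%E ->
  (\int[profile_prob ma mb]_z F z < eps%:E)%E ->
  (forall z x y, mixed_fun (z.1, y) = x -> mixed_fun (z.2, x) = y ->
     (1 <= (payoff i (x, y))%:E + F z)%E) ->
  induces (ma := ma) (mb := mb) U0 ->
  ((1 - eps)%:E < expected_payoff i ma mb)%E.
Proof.
move=> mF F0 Feps payF U0P; rewrite /expected_payoff.
case: xgetP => [_ -> [U [mU Uae] <-]|]; last first.
  by move=> /(_ 'E_(profile_prob ma mb)[fun w => payoff i (U0 w)]%E) []; exists U0.
rewrite unlock; apply: integral_lower_bound mF F0 _ _ Feps.
  by move=> z; rewrite lee_fin payoffE fine_ge0.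
apply: filterS Uae => z [Uz1 Uz2].
by have := payF z (U z).1 (U z).2 Uz1 Uz2; rewrite -surjective_pairing.
Qed.

End matching_pennies.

Theorem proposition3p6 (R : realType) (r : {posnum R}) :
  (forall (mAqua : mixed_strategy r) (eps : R), 0 < eps ->
     exists sBard : strategy r,
       ((1 - eps)%:E < expected_payoff Bard mAqua (pure sBard))%E) /\
  (forall (mBard : mixed_strategy r) (eps : R), 0 < eps ->
     exists sAqua : strategy r,
       ((1 - eps)%:E < expected_payoff Aqua (pure sAqua) mBard)%E).
Proof.
split=> m eps eps0.
- have [s [Y [F [mY eqY mF F0 [Feps Fbound]]]]] := near_perfect_response
    (@mixed_measurable _ _ m) (@mixed_ae_strategy _ _ m) false eps0.
  exists s; apply: (@expected_payoff_gt _ _ _ _ _ (fun z => F z.1) _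
    (fun z => (mixed_fun (z.1, Y z.1), Y z.1))).
  + exact: (measurableT_comp mF (@measurable_fst _ _ _ _)).
  + by move=> z; exact: F0.
  + by rewrite /profile_prob integral_fst.
  + move=> z x y xE yE.
    rewrite -(@payoff_mistakes _ _ Bard false (x, y) x y)// leeD2l// -xE.
    by apply: Fbound; rewrite xE.
  + split; last by apply: filterS (ae_fst (mixed_prob (pure s)) eqY) => z sz; split.
    have mYz : measurable_fun setT
        (fun z : mixed_space m * mixed_space (pure s) => Y z.1).
      exact: (measurableT_comp mY (@measurable_fst _ _ _ _)).
    apply: measurable_fun_pair => //.
    apply: (measurableT_comp (@mixed_measurable _ _ m)).
    exact: measurable_fun_pair.
- have [s [Y [F [mY eqY mF F0 [Feps Fbound]]]]] := near_perfect_response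
    (@mixed_measurable _ _ m) (@mixed_ae_strategy _ _ m) true eps0.
  exists s; apply: (@expected_payoff_gt _ _ _ _ _ (fun z => F z.2) _
    (fun z => (Y z.2, mixed_fun (z.2, Y z.2)))).
  + exact: (measurableT_comp mF (@measurable_snd _ _ _ _)).
  + by move=> z; exact: F0.
  + by rewrite /profile_prob integral_snd.
  + move=> z x y xE yE.
    rewrite -(@payoff_mistakes _ _ Aqua true (x, y) y x).
      by rewrite leeD2l// -yE; apply: Fbound; rewrite yE.
    by move=> t /=; case: (x t) (y t) => -[].
  + split; last by apply: filterS (ae_snd (mixed_prob (pure s)) eqY) => z sz; split.
    have mYz : measurable_fun setT
        (fun z : mixed_space (pure s) * mixed_space m => Y z.2).
      exact: (measurableT_comp mY (@measurable_snd _ _ _ _)).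
    apply: measurable_fun_pair => //.
    apply: (measurableT_comp (@mixed_measurable _ _ m)).
    exact: measurable_fun_pair.
Qed.
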